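(* For every $\delta>0$ there exists $n_0\in\mathbb{N}$ such that for all integers $n\ge n_0$ divisible by $3$ the following holds. Let $H$ be a $(1,3)$-partite $4$-graph with partition classes $Q$ and $P$, where $|P|=n$ and $|Q|=n/3$. Suppose that every vertex of $Q$ is adjacent in $H$ to every vertex of $P$, and that for any $u\in Q$ and distinct $v,v'\in P$ with $\deg_H(\{u,v,v'\})>0$ we have $\deg_H(\{u,v\})+\deg_H(\{u,v'\})>\left(\frac{2}{3}+\delta\right)n^2$. Then $H$ admits a perfect matching.
   Context: A $4$-graph $H$ has edges that are $4$-element subsets of $V(H)$. It is $(1,3)$-partite with partition classes $Q,P$ if $V(H)=Q\sqcup P$ and every edge $e$ satisfies $|e\cap Q|=1$, $|e\cap P|=3$. For $S\subseteq V(H)$, $\deg_H(S)$ is the number of edges containing $S$. Two distinct vertices are adjacent if some edge contains both. A perfect matching is a set of pairwise disjoint edges covering $V(H)$. *)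

(* Defs.v *)
From mathcomp Require Import all_boot all_order all_algebra.
From mathcomp Require Import reals.

Set Implicit Arguments.
Unset Strict Implicit.
Unset Printing Implicit Defensive.

(* A k-graph on the vertex set V is given by its edge set H : {set {set V}};
   its set of vertices V(H) is the whole finite type V. *)
Section Hypergraph.
Variable V : finType.
Implicit Types (H M : {set {set V}}) (S Q P : {set V}) (u v : V).

Definition kgraph (k : nat) H : bool := [forall e in H, #|e| == k].

Definition partite13 H Q P : bool :=
  [&& [disjoint Q & P], Q :|: P == [set: V] &
      [forall e in H, (#|e :&: Q| == 1) && (#|e :&: P| == 3)]].

Definition deg H S : nat := #|[set e in H | S \subset e]|.

Definition adjacent H u v : bool :=
  (u != v) && [exists e in H, (u \in e) && (v \in e)].

Definition perfect_matching H M : bool :=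
  [&& M \subset H, trivIset M & cover M == [set: V]].

End Hypergraph.

(* Main.v *)
Require Import Defs.
From mathcomp Require Import all_boot all_order all_algebra.
From mathcomp Require Import reals.
From mathcomp Require Import zify ring lra.
From mathcomp Require exp sequences.
Import Order.TTheory GRing.Theory Num.Theory.
Local Open Scope ring_scope.
Set Implicit Arguments.
Unset Strict Implicit.
Unset Printing Implicit Defensive.

(** For u in Q let H_u be the 3-graph of the triples completing u to an edge. The
    degree condition makes every link in H_u large and lets only pairwise
    non-adjacent vertices (fewer than n/3 of them) have a small degree in H_u.

    Absorption. Two vertices v, w of P adjacent in H_u share at least n^2/6 link pairs
    in H_u.  Hence for v with many "robust" neighbours w (adjacent in linearly many
    H_u) there are cubically many (u, a, b) completing both v and w to an edge; more
    than half of P is a robust neighbour of v. Three such switches plus one edge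
    {u, w1, w2, w3} form a 12-vertex absorber of {u, v1, v2, v3}. A disjoint family
    giving every 4-set linearly many absorbers is chosen one by one, keeping the
    exponentially weighted count of badly served 4-sets small.

    Almost perfect matching. Among the subgraphs with scaled degrees at most 4, take
    one minimising the sum of (1 - degree)^2. First-order optimality says that
    y = 1 - degree is an almost fractional cover in the dual sense: y(e) <= 0 on all but
    a few edges. Such a y has almost nonpositive total, by a two-point inequality
    applied to a vertex v maximising y and the neighbour of v maximising y. So the
    subgraph is nearly regular in mean square. Deleting its edges greedily, each time
    one for which the mean square deviation from the expected degree does not grow
    more than on average, leaves few vertices uncovered. *)

Local Notation "''1[' b ]" := (nat_of_bool b%R)%:R.

(** * Fractional covers of a 3-graph *)

Section PairInequality.
Variable R : realFieldType.
Implicit Types x y M al n k s q : R.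

(** Since [al <= 3M/2], the second indicator forces [x + y >= 3M/2], which makes the right side at
    least 1; the first forces [x + y >= 3M], which makes it at least 2. *)
Lemma pair_indicator_le1 x y M al :
  0 <= x -> 0 <= y -> 0 < M -> 0 <= al -> 2 * al <= 3 * M ->
  '1[ [&& al <= x, al <= y & 3 * M <= x + y] ] + '1[ 3 * M - al <= x + y ]
  <= 2 / (3 * M) * x + 2 / (3 * M) * y :> R.
Proof.
move=> x0 y0 M0 al0 hal; rewrite -mulrDr mulrAC ler_pdivlMr; last by lra.
case: (lerP (3 * M - al) (x + y)) => h4.
  case: (lerP (3 * M) (x + y)) => h3; first by case: (_ <= x); case: (_ <= y) => /=; lra.
  by rewrite !andbF /=; lra.
case: (lerP (3 * M) (x + y)) => h3; first by lra.
by rewrite !andbF /=; lra.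
Qed.

(** With both arguments at least [al] the right side is 2; with exactly one it is 1 and the first
    indicator vanishes; with none, Markov's bound with [q = 1/(3M - al)] applies. The last terms are
    products of a function of [x] and one of [y], so that sums over pairs factor. *)
Lemma pair_indicator_le2 x y M al q :
  0 <= x -> 0 <= y -> al < 3 * M -> 0 <= q -> q * (3 * M - al) = 1 ->
  '1[ [&& al <= x, al <= y & 3 * M <= x + y] ] + '1[ 3 * M - al <= x + y ]
  <= '1[ al <= x ] + '1[ al <= y ] +
     ((1 - '1[ al <= x ]) * x * q * (1 - '1[ al <= y ]) +
      (1 - '1[ al <= x ]) * ((1 - '1[ al <= y ]) * y * q)) :> R.
Proof.
move=> x0 y0 al3 q0 qE.
have xq : 0 <= x * q by apply: mulr_ge0.
have yq : 0 <= y * q by apply: mulr_ge0.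
have hq : (3 * M - al <= x + y) -> 1 <= x * q + y * q.
  by move=> h; rewrite -mulrDl -qE mulrC ler_wpM2r.
have i3 : 0 <= ('1[ 3 * M <= x + y ] : R) <= 1 by rewrite ler0n lern1 leq_b1.
have i4 : 0 <= ('1[ 3 * M - al <= x + y ] : R) <= 1 by rewrite ler0n lern1 leq_b1.
case: (al <= x); case: (al <= y) => //=; rewrite ?subrr ?subr0 ?mul0r ?mul1r ?mulr0 ?mulr1;
  try lra.
by case: (lerP (3 * M - al) (x + y)) hq => /= _ hq; [have := hq isT; lra | lra].
Qed.

(** In [pair_count_le], [k] is the number of vertices with [X >= al] and [s] is the sum of [X] over
    the others. *)
Lemma quadratic_le (n k s M al q : R) :
  0 < n -> 0 < M -> 3 * M < 2 * al -> al < 3 * M -> k <= n -> n <= 2 * k ->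
  0 <= s -> s + k * al <= M * n -> 0 <= q -> q * (3 * M - al) = 1 ->
  n * k + n * k + (s * q * (n - k) + (n - k) * (s * q)) <= 4 / 3 * n ^+ 2.
Proof.
move=> n0 M0 hal al3 kn hk s0 hs q0 qE.
have hc : 2 * (n - k) * s <= (4 / 3 * n ^+ 2 - 2 * n * k) * (3 * M - al).
  apply: (@le_trans _ _ (2 * (n - k) * (M * n - k * al))).
    by apply: ler_wpM2l; lra.
  have kal : k * al <= M * n by lra.
  rewrite expr2.
  have al2M : al <= 2 * M.
    rewrite -(ler_pM2r n0); apply: le_trans (_ : 2 * (k * al) <= _); last by lra.
    rewrite mulrA mulrC; apply: ler_wpM2r; lra.
  have h1 : 0 <= (2 * k - n) * (M * n - k * al) by apply: mulr_ge0; lra.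
  (* Apart from [h1], the required difference is [n] times the expression in [h3]. That expression
     has slope [3 al - 6M <= 0] in [k], so it is least at [k = M n / al]; there, multiplied by [al],
     it is the first summand here. *)
  have h2 : 0 <= n * (2 / 3 * ((2 * al - 3 * M) * (3 * M - al)))
             + (M * n - k * al) * (6 * M - 3 * al).
    apply: addr_ge0; apply: mulr_ge0; try lra.
    by apply: mulr_ge0; [lra | apply: mulr_ge0; lra].
  have h3 : 0 <= 3 * n * M - 4 / 3 * n * al + k * (3 * al - 6 * M).
    rewrite -(@pmulr_rge0 _ al); [ | by lra].
    lra.
  have h4 := mulr_ge0 (ltW n0) h3.
  lra.
have h5 : 2 * (n - k) * s * q <= 4 / 3 * n ^+ 2 - 2 * n * k.
  have := ler_wpM2r q0 hc.
  by rewrite -[(4 / 3 * _ - _) * _ * q]mulrA [(3 * M - al) * q]mulrC qE mulr1.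
lra.
Qed.

End PairInequality.

Section PairSums.
Variables (R : realFieldType) (V : finType) (P : {set V}).
Let n : R := #|P|%:R.

Lemma sum_const_set (c : R) : \sum_(b in P) c = n * c.
Proof. by rewrite sumr_const -mulr_natl. Qed.

Lemma sum_pairD (f g : V -> R) :
  \sum_(b in P) \sum_(c in P) (f b + g c)
  = n * \sum_(b in P) f b + n * \sum_(c in P) g c.
Proof.
under eq_bigr do rewrite big_split sum_const_set /=.
by rewrite big_split sum_const_set /= -mulr_sumr.
Qed.

Lemma sum_pairM (f g : V -> R) :
  \sum_(b in P) \sum_(c in P) (f b * g c)
  = (\sum_(b in P) f b) * (\sum_(c in P) g c).
Proof. by rewrite mulr_suml; apply: eq_bigr => b _; rewrite mulr_sumr. Qed.

Lemma ler_sum_pair (f g : V -> V -> R) :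
  (forall b c, b \in P -> c \in P -> f b c <= g b c) ->
  \sum_(b in P) \sum_(c in P) f b c <= \sum_(b in P) \sum_(c in P) g b c.
Proof. by move=> fg; apply: ler_sum => b bP; apply: ler_sum => c cP; exact: fg. Qed.

(* Sharp for X = 3M/2 on two thirds of P and X = 0 elsewhere, with al = 3M/2; there
   both indicator sums are dominated by (2/(3M))(X b + X c). For al > 3M/2 that
   linear bound fails, and the hypothesis that half of P has X >= al is needed. *)
Lemma pair_count_le (X : V -> R) (M al : R) :
  (forall b, b \in P -> 0 <= X b) -> 0 < M -> 0 <= al ->
  \sum_(b in P) X b <= M * n ->
  n <= 2 * \sum_(b in P) '1[ al <= X b ] ->
  \sum_(b in P) \sum_(c in P)
     '1[ [&& al <= X b, al <= X c & 3 * M <= X b + X c] ]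
  + \sum_(b in P) \sum_(c in P) '1[ 3 * M - al <= X b + X c ]
  <= 4 / 3 * n ^+ 2.
Proof.
move=> X0 M0 al0 sumX hk.
have n0 : 0 <= n by rewrite ler0n.
have [P0|Pn0] := eqVneq P set0.
  by rewrite P0 !big_set0 addr0; apply: mulr_ge0; [lra | exact: exprn_ge0].
have n00 : 0 < n by rewrite /n ltr0n card_gt0.
rewrite -big_split /=; under eq_bigr do rewrite -big_split /=.
case: (lerP (2 * al) (3 * M)) => hal.
  apply: (@le_trans _ _ (\sum_(b in P) \sum_(c in P)
      (2 / (3 * M) * X b + 2 / (3 * M) * X c))).
    by apply: ler_sum_pair => b c bP cP; apply: pair_indicator_le1; rewrite ?X0.
  rewrite sum_pairD -!mulr_sumr.
  set S : R := \sum_(b in P) X b in sumX *.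
  have -> : n * (2 / (3 * M) * S) + n * (2 / (3 * M) * S) = n * (4 / 3 * S / M).
    by field; rewrite gt_eqF.
  rewrite expr2 (mulrCA (4 / 3)); apply: ler_wpM2l => //.
  by rewrite ler_pdivrMr //; lra.
set k : R := \sum_(b in P) '1[ al <= X b ] in hk.
have kn : k <= n.
  by rewrite /k /n -sum1_card natr_sum; apply: ler_sum => b _; rewrite ler_nat leq_b1.
set SL : R := \sum_(b in P) (1 - '1[ al <= X b ]) * X b.
have SLe : SL + k * al <= M * n.
  apply: le_trans sumX; rewrite /SL /k mulr_suml -big_split /=.
  apply: ler_sum => b bP; have := X0 b bP; case: (lerP al (X b)) => /= h hx; lra.
have SL0 : 0 <= SL.
  apply: sumr_ge0 => b bP; apply: mulr_ge0; last exact: X0.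
  by case: (al <= X b) => /=; lra.
have al2 : al < 3 * M.
  case: (ltrP al (3 * M)) => // h; nra.
have [q q0 qE] : exists2 q : R, 0 <= q & q * (3 * M - al) = 1.
  by exists (3 * M - al)^-1; [rewrite invr_ge0; lra | rewrite mulVf // gt_eqF; lra].
apply: (@le_trans _ _ (\sum_(b in P) \sum_(c in P)
   (('1[ al <= X b ] + '1[ al <= X c ]) +
     (((1 - '1[ al <= X b ]) * X b * q) * (1 - '1[ al <= X c ]) +
     (1 - '1[ al <= X b ]) * (((1 - '1[ al <= X c ]) * X c) * q))))).
  by apply: ler_sum_pair => b c bP cP; apply: pair_indicator_le2; rewrite ?X0.
under eq_bigr do rewrite big_split /=.
rewrite big_split /= sum_pairD.
under [X in _ + X]eq_bigr do rewrite big_split /=.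
rewrite big_split /= !sum_pairM -!mulr_suml -/k -/SL.
have -> : \sum_(c in P) (1 - '1[ al <= X c ]) = n - k.
  by rewrite sumrB sum_const_set mulr1.
exact: quadratic_le qE.
Qed.

End PairSums.

Section FractionalCover.
Variables (R : realFieldType) (V : finType) (P : {set V}).
Variable T : V -> V -> V -> bool.
Hypothesis TC' : forall a b c, T a b c -> T a c b.
Variables (d : R) (y : V -> R).
Let n : R := #|P|%:R.
Let dg v : R := \sum_(b in P) \sum_(c in P) '1[ T v b c ].
Let bad v : R := \sum_(b in P) \sum_(c in P) '1[ T v b c && (0 < y v + y b + y c) ].
Let Z := [set v in P | d / 8 * n ^+ 2 < bad v].

Let sum_Z : \sum_(c in P) '1[ c \in Z ] = #|Z|%:R :> R.
Proof.
rewrite -sum1_card natr_sum big_mkcond [RHS]big_mkcond /=.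
by apply: eq_bigr => c _; rewrite inE; case: (c \in P); case: (_ < _).
Qed.

Let sum_pairZ : \sum_(b in P) \sum_(c in P) ('1[ b \in Z ] + '1[ c \in Z ])
   = 2 * #|Z|%:R * n :> R.
Proof.
by rewrite sum_pairD -/n sum_Z; ring.
Qed.

(** A link pair of [v] meets [Z], or is one of the few bad pairs, or satisfies the cover inequality;
    only pairs of the last kind have to be described by [F]. *)
Let dg_le v (F : V -> V -> bool) : v \in P -> v \notin Z ->
  (forall b c, b \in P -> c \in P -> b \notin Z -> c \notin Z ->
     T v b c -> y v + y b + y c <= 0 -> F b c) ->
  dg v <= \sum_(b in P) \sum_(c in P) '1[ F b c ] + d / 8 * n ^+ 2 + 2 * #|Z|%:R * n.
Proof.
move=> vP vZ hF.
have badv : bad v <= d / 8 * n ^+ 2.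
  by move: vZ; rewrite inE vP /= -leNgt.
apply: (@le_trans _ _ (\sum_(b in P) \sum_(c in P) '1[ F b c ] + bad v + 2 * #|Z|%:R * n)); last by rewrite lerD2r lerD2l.
rewrite -sum_pairZ /dg /bad -!big_split /=; apply: ler_sum => b bP.
rewrite -!big_split /=; apply: ler_sum => c cP.
case: ltrP => h.
  rewrite andbT -!natrD ler_nat.
  by case: (F b c); case: (T v b c); case: (b \in Z); case: (c \in Z).
rewrite andbF addr0 -!natrD ler_nat.
case Tv: (T v b c) => //; have := hF b c bP cP.
case: (b \in Z); case: (c \in Z) => hF'; rewrite ?addnS //.
by rewrite hF'.
Qed.

Hypothesis d0 : 0 < d.
Hypothesis d1 : d <= 1.
Hypothesis dgP : forall v, v \in P -> (1 / 3 + d) * n ^+ 2 <= dg v.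
Hypothesis dgPP : forall v a b, v \in P -> a \in P -> b \in P ->
  T v a b -> (4 / 3 + d) * n ^+ 2 <= dg v + dg a.
Hypothesis yb : forall v, v \in P -> -5 <= y v <= 2.

(** If the truncated sum were positive, [X = M - min(y, M)] would have mean at most [M]. The cover
    inequality becomes [X b + X c >= 3M] on the link of [v] and [X b + X c >= 3M - (M - A)] on the
    link of [a], so [pair_count_le] bounds [dg v + dg a] by [4/3 n^2] plus an error of [3/4 d n^2],
    against [dgPP]. *)
Let cover_few_bad : 0 < n -> #|Z|%:R <= d / 8 * n -> \sum_(v in P) y v <= 7 * #|Z|%:R.
Proof.
move=> n0 Zn.
have Zn2 : 2 * #|Z|%:R * n <= d / 4 * n ^+ 2.
  by rewrite expr2 mulrA; apply: ler_wpM2r; lra.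
have dn2 : 0 < d * n ^+ 2 by rewrite mulr_gt0 // exprn_gt0.
have n2 : 0 < n ^+ 2 by rewrite exprn_gt0.
have dn : d * n <= n by rewrite ler_piMl // ltW.
have [v0 v0G] : exists v0, v0 \in P :\: Z.
  apply/set0Pn/negP => /eqP e.
  have : n <= #|Z|%:R by rewrite ler_nat; apply: subset_leq_card; rewrite -setD_eq0 e.
  lra.
(* v maximises y outside the bad set Z, and a maximises y among the neighbours of v
   outside Z, so that the link of v lives on {y <= y a}. *)
case: (arg_maxP y v0G) => v vG vmax.
have [vP vZ] := setDP vG.
pose N := [set a in P :\: Z | [exists b, (b \in P) && T v a b]].
have [a0 a0N] : exists a0, a0 \in N.
  apply/set0Pn/negP => /eqP e.
  have := @dg_le v (fun _ _ => false) vP vZ; rewrite !big1_eq.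
  have := dgP vP => h1 h2; suff: dg v <= 0 + d / 8 * n ^+ 2 + 2 * #|Z|%:R * n by nra.
  apply: h2 => b c bP cP bZ cZ Tv _.
  have : b \in N.
    by apply/setIdP; split; [exact/setDP | apply/existsP; exists c; rewrite cP].
  by rewrite e inE.
case: (arg_maxP y a0N) => a /setIdP[/setDP[aP aZ] /existsP[b' /andP[b'P Tvab']]] amax.
set M := y v; set A := y a.
have aM : A <= M by apply: vmax; apply/setDP.
(* Only vertices of [Z] can exceed [M]. Truncating costs at most [7 = 2 - (-5)] at each of them and
   keeps [X] nonnegative. *)
pose y' b := Num.min (y b) M.
have yy' b : b \in P -> y b <= y' b + 7 * '1[ b \in Z ].
  move=> bP; rewrite /y'; have := yb bP; have := yb vP; rewrite -/M.
  case bZ: (b \in Z) => /= h1 h2; last first.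
    by rewrite min_l ?mulr0 ?addr0 //; apply: vmax; apply/setDP; rewrite bZ.
  by rewrite minEle; case: ifP => _; lra.
suff sy' : \sum_(b in P) y' b <= 0.
  apply: (@le_trans _ _ (\sum_(b in P) (y' b + 7 * '1[ b \in Z ]))).
    exact: ler_sum.
  by rewrite big_split /= -mulr_sumr sum_Z; lra.
have [M0|M0] := lerP M 0.
  by apply: sumr_le0 => b _; rewrite /y' ge_min M0 orbT.
rewrite leNgt; apply/negP => sy'.
pose X b := M - y' b.
have X0 b : b \in P -> 0 <= X b by rewrite /X subr_ge0 ge_min lexx orbT.
have sX : \sum_(b in P) X b <= M * n.
  by rewrite /X sumrB sum_const_set -/n; lra.
have XE b : b \in P -> b \notin Z -> X b = M - y b.
  by move=> bP bZ; rewrite /X /y' min_l //; apply: vmax; apply/setDP; rewrite bZ.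
have hv := @dg_le v (fun b c => [&& M - A <= X b, M - A <= X c & 3 * M <= X b + X c]) vP vZ.
have ha := @dg_le a (fun b c => 3 * M - (M - A) <= X b + X c) aP aZ.
set F1 := \sum_(b in P) _ in hv; set F2 := \sum_(b in P) _ in ha.
have {}hv : dg v <= F1 + d / 8 * n ^+ 2 + 2 * #|Z|%:R * n.
  apply: hv => b c bP cP bZ cZ Tv ys.
  have yA : y b <= A.
    by apply: amax; apply/setIdP; split; [exact/setDP | apply/existsP; exists c; rewrite cP].
  have yA' : y c <= A.
    by apply: amax; apply/setIdP; split; [exact/setDP | apply/existsP; exists b; rewrite bP TC'].
  by rewrite !XE //; apply/and3P; split; move: ys; rewrite -/M; lra.
have {}ha : dg a <= F2 + d / 8 * n ^+ 2 + 2 * #|Z|%:R * n.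
  by apply: ha => b c bP cP bZ cZ Ta ys; rewrite !XE //; move: ys; rewrite -/A; lra.
(* Up to [3/8 d n^2] pairs, the link of [v] lives on vertices with [X >= M - A]. Fewer than [n/2] of
   them would span at most [n^2/4] pairs, too few for [(1/3 + d) n^2]. *)
have hk : n <= 2 * \sum_(b in P) '1[ M - A <= X b ].
  set k := \sum_(b in P) _.
  have F1k : F1 <= k * k.
    rewrite /k -sum_pairM; apply: ler_sum_pair => b c _ _.
    by rewrite -natrM ler_nat; case: (M - A <= X b); case: (M - A <= X c) => //=; rewrite leq_b1.
  have k0 : 0 <= k by apply: sumr_ge0.
  rewrite leNgt; apply/negP => hn.
  have : k * k <= n / 2 * (n / 2) by apply: ler_pM; lra.
  have := dgP vP; move: hv dn2 Zn2; rewrite expr2; lra.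
have := @pair_count_le R V P X M (M - A) X0 M0; rewrite -/F1 -/F2 -/n => hp.
have {}hp := hp ltac:(lra) sX hk.
have := dgPP vP aP b'P Tvab'.
lra.
Qed.

(** Markov's inequality bounds [d n^2 |Z|] by 8 times the sum of [bad]. A small [Z] is handled by
    [cover_few_bad]; if [|Z| > d n / 8], the trivial bound [2n] on the sum of [y] suffices, with
    [128 = 2 * 8 * 8]. *)
Lemma fractional_cover_le :
  (\sum_(v in P) y v) * (d ^+ 2 * n ^+ 2) <= 128 * \sum_(v in P) bad v.
Proof.
have bad0 v : 0 <= bad v by apply: sumr_ge0 => b _; apply: sumr_ge0.
have g0 : 0 <= \sum_(v in P) bad v by apply: sumr_ge0.
have [P0|Pn0] := eqVneq P set0.
  by move: g0; rewrite P0 !big_set0 mul0r; lra.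
have n0 : 0 < n by rewrite /n ltr0n card_gt0.
have n2 : 0 < n ^+ 2 by rewrite exprn_gt0.
have gZ : #|Z|%:R * (d * n ^+ 2) <= 8 * \sum_(v in P) bad v.
  rewrite -sum_Z mulr_suml mulr_sumr; apply: ler_sum => v vP.
  case vZ : (v \in Z) => /=; last by have := bad0 v; lra.
  by move: vZ; rewrite inE vP /=; lra.
have few : #|Z|%:R <= d / 8 * n -> \sum_(v in P) y v <= 7 * #|Z|%:R by exact: cover_few_bad.
have sy2 : \sum_(v in P) y v <= 2 * n.
  by rewrite mulrC -sum_const_set; apply: ler_sum => v vP; case/andP: (yb vP).
move: few sy2 gZ g0 n0 n2 (ler0n R #|Z|).
move: (\sum_(v in P) y v) (\sum_(v in P) bad v) (#|Z|%:R : R) n => S g z m.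
move=> few sy2 gZ g0 m0 m2 z0.
have d2 : d ^+ 2 <= d by rewrite expr2 ler_piMl // ltW.
have dm : 0 <= d ^+ 2 * m ^+ 2 by rewrite mulr_ge0 // exprn_ge0 // ltW.
have [Zn|Zn] := lerP z (d / 8 * m).
  apply: le_trans (ler_wpM2r dm (few Zn)) _.
  have : z * (d ^+ 2 * m ^+ 2) <= z * (d * m ^+ 2).
    by apply: ler_wpM2l => //; apply: ler_wpM2r => //; exact: ltW.
  lra.
apply: le_trans (ler_wpM2r dm sy2) _.
have : d * m * (d * m ^+ 2) <= 8 * z * (d * m ^+ 2).
  by apply: ler_wpM2r; [apply: mulr_ge0; exact: ltW | lra].
rewrite expr2; lra.
Qed.

End FractionalCover.

(** * Matchable vertex sets *)

Section Matchable.
Variables (V : finType) (E : {set {set V}}).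
Implicit Types (X Y e : {set V}) (M : {set {set V}}).

Definition matchable X :=
  [exists M : {set {set V}}, [&& M \subset E, trivIset M & cover M == X]].

Lemma matchable0 : matchable set0.
Proof.
apply/existsP; exists set0; rewrite sub0set /cover big_set0 eqxx andbT /=.
by apply/trivIsetP => A B; rewrite inE.
Qed.

Lemma matchable1 e : e \in E -> matchable e.
Proof.
move=> eE; apply/existsP; exists [set e]; rewrite sub1set eE /cover big_set1 eqxx andbT /=.
by apply/trivIsetP => A B; rewrite !inE => /eqP -> /eqP ->; rewrite eqxx.
Qed.

Lemma matchableU X Y : [disjoint X & Y] -> matchable X -> matchable Y -> matchable (X :|: Y).
Proof.
move=> dXY /existsP[M1 /and3P[s1 t1 /eqP c1]] /existsP[M2 /and3P[s2 t2 /eqP c2]].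
apply/existsP; exists (M1 :|: M2); apply/and3P; split.
- by rewrite subUset s1.
- have d12 A B : A \in M1 -> B \in M2 -> [disjoint A & B].
    move=> A1 B2; apply: disjointWl (disjointWr _ dXY).
      by rewrite -c1; apply: bigcup_sup A1.
    by rewrite -c2; apply: bigcup_sup B2.
  apply/trivIsetP => A B /setUP[] hA /setUP[] hB AB.
  + by apply: (trivIsetP t1).
  + exact: d12.
  + by rewrite disjoint_sym; apply: d12.
  + by apply: (trivIsetP t2).
- by rewrite /cover bigcup_setU; apply/eqP; congr (_ :|: _).
Qed.

End Matchable.

Lemma matchableS (V : finType) (E E' : {set {set V}}) (X : {set V}) :
  E \subset E' -> matchable E X -> matchable E' X.
Proof.
move=> sE /existsP[M /and3P[s t c]]; apply/existsP; exists M; rewrite t c !andbT.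
exact: subset_trans sE.
Qed.

(** * Greedy nibble *)

Lemma sqr_sum_le (R : realFieldType) (V : finType) (A : {set V}) (f : V -> R) :
  (\sum_(v in A) f v) ^+ 2 <= #|A|%:R * \sum_(v in A) f v ^+ 2.
Proof.
have : 0 <= \sum_(b in A) \sum_(c in A) (f b - f c) ^+ 2.
  by apply: sumr_ge0 => b _; apply: sumr_ge0 => c _; apply: sqr_ge0.
have -> : \sum_(b in A) \sum_(c in A) (f b - f c) ^+ 2 =
   \sum_(b in A) \sum_(c in A) (f b ^+ 2 + f c ^+ 2)
   - 2 * \sum_(b in A) \sum_(c in A) (f b * f c).
  rewrite mulr_sumr -sumrB; apply: eq_bigr => b _.
  by rewrite mulr_sumr -sumrB; apply: eq_bigr => c _; ring.
rewrite sum_pairD sum_pairM expr2; lra.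
Qed.

Section OneStep.
Variables (R : realFieldType) (V : finType) (E : {set {set V}}).
Variables (h kap N : R).
Implicit Types (A e f : {set V}) (u v : V).

Definition edges_in A := [set e in E | e \subset A].
Definition wdeg A v : R := h * \sum_(e in edges_in A) '1[ v \in e ].
(* (|A|/N)^3 is the weighted degree expected when A is a random |A|-subset of N
   vertices of weighted degree 1 in a 4-graph. *)
Definition discrepancy A : R :=
  \sum_(v in A) (wdeg A v - (#|A|%:R / N) ^+ 3) ^+ 2.

Hypothesis E4 : forall e, e \in E -> #|e| = 4%N.
Hypothesis h0 : 0 < h.
Hypothesis N1 : 1 <= N.
Hypothesis kapN : 1 <= kap * N.
Hypothesis codegE : forall u v, u != v ->
  h * \sum_(e in E) '1[ (u \in e) && (v \in e) ] <= kap.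
Hypothesis degE : forall v, h * \sum_(e in E) '1[ v \in e ] <= 4.

Let N0 : 0 < N. Proof. exact: lt_le_trans ltr01 N1. Qed.
Let kap0 : 0 < kap.
Proof. by rewrite -(pmulr_lgt0 _ N0); exact: lt_le_trans ltr01 kapN. Qed.
Let invN0 : 0 < N^-1. Proof. by rewrite invr_gt0. Qed.
Let invN1 : N^-1 <= 1. Proof. by rewrite invf_le1. Qed.
Let invNkap : N^-1 <= kap.
Proof. by rewrite -[N^-1]mul1r ler_pdivrMr. Qed.

Variable A : {set V}.
Hypothesis AN : #|A|%:R <= N.

Let F := edges_in A.
Let x := wdeg A.
Let p : R := #|A|%:R / N.
Let t : R := p ^+ 3.
(** The drop of the target degree [t] when one edge, that is four vertices, is deleted. *)
Let tau : R := p ^+ 3 - (p - 4 / N) ^+ 3.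
Let y v : R := x v - t.
Let hW : R := h * #|F|%:R.
(** The weighted degree that a vertex [v] outside [e] loses when the vertices of [e] are deleted. *)
Let L e v : R := h * \sum_(f in F) '1[ (v \in f) && ~~ [disjoint f & e] ].

Let p0 : 0 <= p. Proof. by rewrite /p mulr_ge0 // ltW. Qed.
Let p1 : p <= 1. Proof. by rewrite /p ler_pdivrMr ?mul1r. Qed.
Let t0 : 0 <= t. Proof. by rewrite exprn_ge0. Qed.
Let t1 : t <= 1. Proof. by rewrite exprn_ile1. Qed.
Let pN : p * N = #|A|%:R. Proof. by rewrite /p mulfVK // gt_eqF. Qed.

Let F4 f : f \in F -> #|f| = 4%N. Proof. by rewrite inE => /andP[/E4]. Qed.
Let FA f : f \in F -> f \subset A. Proof. by rewrite inE => /andP[]. Qed.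
Let FE f : f \in F -> f \in E. Proof. by rewrite inE => /andP[]. Qed.

Let ler_sumF (g : {set V} -> R) : (forall f, 0 <= g f) ->
  \sum_(f in F) g f <= \sum_(f in E) g f.
Proof.
move=> g0; rewrite big_mkcond [leRHS]big_mkcond /=; apply: ler_sum => f _.
by case: ifP => [/FE -> //|_]; case: ifP.
Qed.

Let x0 v : 0 <= x v.
Proof. by apply: mulr_ge0; [exact: ltW | apply: sumr_ge0]. Qed.
Let x4 v : x v <= 4.
Proof.
apply: le_trans (degE v); apply: ler_wpM2l; first exact: ltW.
exact: ler_sumF.
Qed.

Let sumF_sub (G : {set V} -> V -> R) f : f \in F ->
  \sum_(v in A) '1[ v \in f ] * G f v = \sum_(v in f) G f v.
Proof.
move=> /FA /subsetP fA; rewrite big_mkcond [RHS]big_mkcond /=; apply: eq_bigr => v _.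
case: ifP; case: ifP => //= hf; rewrite ?mul1r ?mul0r //.
by move=> hA; have := fA v hf; rewrite hA.
Qed.

Let sum_card f : \sum_(v in f) (1 : R) = #|f|%:R.
Proof. by rewrite sumr_const. Qed.

Let sumA1 f : f \in F -> \sum_(v in A) '1[ v \in f ] = 4 :> R.
Proof.
move=> fF; rewrite -(F4 fF) -sum_card -(sumF_sub (fun _ _ => 1) fF).
by apply: eq_bigr => v _; rewrite mulr1.
Qed.

Lemma sum_wdeg : 4 * (h * #|edges_in A|%:R) = \sum_(v in A) wdeg A v.
Proof.
rewrite /wdeg -mulr_sumr exchange_big /= mulrCA; congr (_ * _).
by rewrite (eq_bigr _ sumA1) sumr_const mulr_natr.
Qed.

Let hWN : hW <= N.
Proof.
have : \sum_(v in A) x v <= 4 * N.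
  apply: (@le_trans _ _ (\sum_(v in A) 4)); first by apply: ler_sum.
  rewrite sumr_const -mulr_natl mulrC; move: AN; lra.
by rewrite -sum_wdeg -/hW; lra.
Qed.

Lemma wdegD e v : e \in F -> v \in A :\: e -> wdeg (A :\: e) v = x v - L e v.
Proof.
move=> eF vAe; rewrite /x /wdeg /L -mulrBr; congr (_ * _).
rewrite -sumrB big_mkcond [RHS]big_mkcond /=; apply: eq_bigr => f _.
rewrite !inE subsetD; case: (f \in E) => //=; case: (f \subset A) => //=.
by case: [disjoint f & e]; case: (v \in f) => /=; lra.
Qed.

Lemma tgtD e : e \in F -> (#|A :\: e|%:R / N) ^+ 3 = t - tau.
Proof.
move=> eF; have -> : #|A :\: e|%:R = #|A|%:R - 4 :> R.
  have := cardsID e A; rewrite (setIidPr (FA eF)) F4 // => <-.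
  by rewrite natrD addrAC subrr add0r.
by rewrite mulrBl -/p /t /tau subKr.
Qed.

Hypothesis A4 : (4 <= #|A|)%N.

Let p4 : 4 / N <= p.
Proof. by rewrite /p ler_wpM2r ?ler_nat // ltW. Qed.

Let tau_bounds : 0 <= tau <= 12 * N^-1.
Proof.
move: p0 p1 p4 invN0; rewrite /tau; move: p N^-1 => q m q0 q1 qm m0.
have -> : q ^+ 3 - (q - 4 * m) ^+ 3
   = m * (4 * (q ^+ 2 + q * (q - 4 * m) + (q - 4 * m) ^+ 2)) by ring.
have q2 : q ^+ 2 <= 1 by apply: exprn_ile1.
have q3 : 0 <= q * (q - 4 * m) <= 1 by apply/andP; split; nra.
have q4 : 0 <= (q - 4 * m) ^+ 2 <= 1.
  by rewrite sqr_ge0 exprn_ile1 //; lra.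
have q5 : 0 <= q ^+ 2 by apply: sqr_ge0.
apply/andP; split; first by apply: mulr_ge0; lra.
by rewrite mulrC; apply: ler_wpM2r; lra.
Qed.

(** [S v] is the weighted total of the losses of [v] over the edges avoiding it. [D v] estimates it
    by the degrees of the other vertices in the edges at [v], counting an edge once for each vertex
    in which it meets them. *)
Let S v : R := h * \sum_(e in F) '1[ v \notin e ] * L e v.
Let D v : R := h * \sum_(f in F) '1[ v \in f ] * \sum_(u in f | u != v) x u.

(** If [e] contains [v], every other common vertex pairs up with [v]; if not, one common vertex is
    paid for by the indicator and the others pair up with it. *)
Let overlap (e f : {set V}) v : v \in f ->
  ((v \notin e) && ~~ [disjoint f & e] <= \sum_(u in f | u != v) (u \in e)
   <= ((v \notin e) && ~~ [disjoint f & e])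
      + \sum_(u in f) \sum_(u' in f | u' != u) ((u \in e) && (u' \in e)))%N.
Proof.
move=> vf; apply/andP; split.
  case ve: (v \in e) => //=; case: (boolP [disjoint f & e]) => //.
  move=> /pred0Pn[u /= /andP[uf ue]].
  rewrite (bigD1 u) /= ?ue ?leq_addr // uf /=.
  by apply: contraFneq ve => <-.
case ve: (v \in e) => /=.
  rewrite add0n [leqRHS](bigD1 v) //= ve; exact: leq_addr.
case: (boolP [disjoint f & e]) => /= [|/pred0Pn[u /= /andP[uf ue]]].
  move=> /pred0P dis; rewrite big1 // => u /andP[uf _].
  by have := dis u; rewrite /= uf /= => ->.
rewrite [X in (_ <= _ + X)%N](bigD1 u) //= ue addnA; apply: leq_trans (leq_addr _ _).
apply: (@leq_trans (\sum_(u' in f) (u' \in e))).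
  by rewrite [leqRHS](bigD1 v) //= ve.
by rewrite (bigD1 u) //= ue.
Qed.

(** Exchanging sums reduces both to counting, for an edge [f] at [v], the edges meeting [f]. By
    [overlap] the counts differ by pairs of vertices of [f] in a common edge: at most 16 pairs of
    weight [kap], times a degree of at most 4. *)
Let DS v : 0 <= D v - S v <= 64 * kap.
Proof.
pose b e f : R := '1[ (v \notin e) && ~~ [disjoint f & e] ].
have SE : S v = h * \sum_(f in F) '1[ v \in f ] * (h * \sum_(e in F) b e f).
  rewrite /S /L; congr (_ * _).
  under eq_bigr do rewrite mulrCA mulr_sumr.
  under [RHS]eq_bigr do rewrite mulrCA mulr_sumr.
  rewrite -!mulr_sumr exchange_big /=; congr (_ * _).
  apply: eq_bigr => f _; apply: eq_bigr => e _; rewrite /b -!natrM.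
  by case: (v \in e); case: (v \in f); case: [disjoint f & e].
have DE : D v = h * \sum_(f in F) '1[ v \in f ] *
    (h * \sum_(e in F) \sum_(u in f | u != v) '1[ u \in e ]).
  congr (_ * _); apply: eq_bigr => f _; congr (_ * _).
  by rewrite exchange_big /= mulr_sumr.
rewrite SE DE -mulrBr -sumrB.
pose c f : R := h * \sum_(e in F) (\sum_(u in f | u != v) '1[ u \in e ] - b e f).
have -> : \sum_(f in F) ('1[ v \in f ] * (h * \sum_(e in F) \sum_(u in f | u != v) '1[ u \in e ])
   - '1[ v \in f ] * (h * \sum_(e in F) b e f)) = \sum_(f in F) '1[ v \in f ] * c f.
  by apply: eq_bigr => f _; rewrite -mulrBr -mulrBr -sumrB.
have cb f : f \in F -> v \in f -> 0 <= c f <= 16 * kap.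
  move=> fF vf; rewrite /c; apply/andP; split.
    apply: mulr_ge0; first exact: ltW.
    apply: sumr_ge0 => e _; rewrite subr_ge0 /b -natr_sum ler_nat.
    by case/andP: (overlap e vf).
  apply: (@le_trans _ _ (h * \sum_(e in F) \sum_(u in f) \sum_(u' in f | u' != u) '1[ (u \in e) && (u' \in e) ])).
    apply: ler_wpM2l; first exact: ltW.
    apply: ler_sum => e _; rewrite lerBlDl /b -natr_sum.
    under [X in _ + X]eq_bigr do rewrite -natr_sum.
    by rewrite -natr_sum -natrD ler_nat; case/andP: (overlap e vf).
  rewrite exchange_big mulr_sumr /=.
  apply: (@le_trans _ _ (\sum_(u in f) \sum_(u' in f) kap)).
    apply: ler_sum => u uf; rewrite exchange_big mulr_sumr /=.
    rewrite big_mkcondr /=; apply: ler_sum => u' u'f; case: ifP => uu'; last exact: ltW.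
    have uu : u != u' by rewrite eq_sym.
    apply: le_trans (codegE uu); apply: ler_wpM2l; first exact: ltW.
    exact: ler_sumF.
  by rewrite !sumr_const !F4 // -mulrnA mulr_natl lexx.
apply/andP; split.
  apply: mulr_ge0; first exact: ltW.
  apply: sumr_ge0 => f fF; case vf: (v \in f); rewrite ?mul0r ?mul1r //.
  by case/andP: (cb f fF vf).
apply: (@le_trans _ _ (x v * (16 * kap))).
  rewrite /x /wdeg -mulrA; apply: ler_wpM2l; first exact: ltW.
  rewrite mulr_suml; apply: ler_sum => f fF; case vf: (v \in f); rewrite ?mul0r ?mul1r //.
  by case/andP: (cb f fF vf).
have := ler_wpM2r (ltW kap0) (x4 v); lra.
Qed.

Let C v : R := h * \sum_(f in F) '1[ v \in f ] * \sum_(u in f | u != v) y u.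
Let Phi : R := \sum_(v in A) y v ^+ 2.
Let Y : R := \sum_(v in A) y v.

Let DC v : D v = 3 * t * x v + C v.
Proof.
rewrite /D /C /x /wdeg mulrCA -mulrDr; congr (_ * _).
rewrite mulr_sumr -big_split /=; apply: eq_bigr => f fF.
case vf: (v \in f); rewrite ?mul0r ?mulr0 ?addr0 // !mul1r mulr1.
have -> : 3 * t = \sum_(u in f | u != v) t.
  rewrite (eq_bigl (mem (f :\ v))); last by move=> u; rewrite !inE andbC.
  have c3 : #|f :\ v| = 3%N by have := cardsD1 v f; rewrite vf F4 //= add1n => -[<-].
  by rewrite sumr_const c3 mulr_natl.
by rewrite -big_split /=; apply: eq_bigr => u _; rewrite /y addrC subrK.
Qed.

(** In an edge, the sum over ordered pairs of distinct vertices is the square of the sum minus the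
    sum of squares. Dropping the square leaves minus the sum of [x v * y v ^+ 2], and [x v <= 4]. *)
Let cross : - (4 * Phi) <= \sum_(v in A) y v * C v.
Proof.
have -> : \sum_(v in A) y v * C v
   = h * \sum_(f in F) \sum_(v in f) \sum_(u in f | u != v) y v * y u.
  rewrite /C; under eq_bigr do rewrite mulrCA mulr_sumr.
  rewrite -mulr_sumr exchange_big /=; congr (_ * _); apply: eq_bigr => f fF.
  rewrite -(sumF_sub (fun f v => \sum_(u in f | u != v) y v * y u) fF).
  by apply: eq_bigr => v _; rewrite mulrCA; congr (_ * _); rewrite mulr_sumr.
have -> : 4 * Phi = \sum_(v in A) 4 * y v ^+ 2 by rewrite mulr_sumr.
apply: (@le_trans _ _ (- (h * \sum_(f in F) \sum_(v in f) y v ^+ 2))).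
  rewrite lerN2.
  have -> : h * \sum_(f in F) \sum_(v in f) y v ^+ 2 = \sum_(v in A) x v * y v ^+ 2.
    rewrite /x /wdeg; under [RHS]eq_bigr do rewrite -mulrA mulr_suml.
    rewrite -mulr_sumr exchange_big /=; congr (_ * _); apply: eq_bigr => f fF.
    by rewrite (sumF_sub (fun f v => y v ^+ 2) fF).
  by apply: ler_sum => v _; apply: ler_wpM2r; [exact: sqr_ge0 | exact: x4].
rewrite -mulrN; apply: ler_wpM2l; first exact: ltW.
rewrite -sumrN; apply: ler_sum => f _.
have -> : \sum_(v in f) \sum_(u in f | u != v) y v * y u
    = (\sum_(v in f) y v) ^+ 2 - \sum_(v in f) y v ^+ 2.
  rewrite expr2 mulr_suml -sumrB; apply: eq_bigr => v vf.
  by rewrite mulr_sumr [in RHS](bigD1 v) //= expr2 addrC addrK.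
by rewrite lerDr sqr_ge0.
Qed.

(** The weighted sum of [L e v - tau] over the edges [e] avoiding [v]: the loss of degree in excess
    of the drop of the target. *)
Let G v : R := S v - (hW - x v) * tau.

(** Replacing [S] by [D] costs [64 kap] and [x v * tau] is at most [48 kap], with opposite signs.
    The constant terms [3 t^2] and [p N t tau / 4] agree up to [16 kap] because [tau] is about
    [12 p^2 / N]; this cancellation is why the target is the cube of [p]. *)
Let G_approx v : `|G v - (3 * t * y v + C v - Y * tau / 4)| <= 80 * kap.
Proof.
have xt : 0 <= x v * tau <= 48 * kap.
  case/andP: tau_bounds => tau0 tau1; rewrite mulr_ge0 //=.
  apply: (@le_trans _ _ (4 * (12 * N^-1))); first exact: ler_pM.
  by have := invNkap; lra.
have hWE : 4 * hW = p * N * t + Y.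
  rewrite sum_wdeg -/x pN /Y /y sumrB sumr_const -[t *+ _]mulr_natl; lra.
have tb : - (16 * kap) <= 3 * t * t - p * N * t * tau / 4 <= 12 * kap.
  have -> : 3 * t * t - p * N * t * tau / 4 = (p * t) * (12 * (p * N^-1) - 16 * (N^-1 * N^-1)).
    by rewrite /tau /t; field; rewrite gt_eqF.
  have pt : 0 <= p * t <= 1 by rewrite mulr_ge0 // mulr_ile1.
  have pm : 0 <= p * N^-1 <= kap.
    apply/andP; split; first by apply: mulr_ge0 => //; exact: ltW.
    apply: le_trans _ invNkap.
    by rewrite ler_piMl // ltW.
  have mm : 0 <= N^-1 * N^-1 <= kap.
    apply/andP; split; first by apply: mulr_ge0 => //; exact: ltW.
    apply: le_trans _ invNkap.
    by rewrite ler_piMl // ltW.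
  move: (p * t) (p * N^-1) (N^-1 * N^-1) kap pt pm mm kap0 => a b c k ha hb hc k0.
  by apply/andP; split; nra.
have -> : G v - (3 * t * y v + C v - Y * tau / 4)
  = - (D v - S v) + x v * tau + (3 * t * t - p * N * t * tau / 4).
  have hWE' : hW = (p * N * t + Y) / 4 by rewrite -hWE; field.
  rewrite /G hWE' DC /y.
  by move: (S v) (x v) (C v) t tau N p Y => S' x' C' t' tau' N' p' Y'; field.
rewrite ler_norml; move: xt tb (DS v).
move: (D v - S v) (x v * tau) (3 * t * t - p * N * t * tau / 4) kap kap0 => a b c k k0 hb hc ha.
by apply/andP; split; lra.
Qed.

Let Phi0 : 0 <= Phi. Proof. by apply: sumr_ge0 => v _; apply: sqr_ge0. Qed.

(** The term [3 t Phi] has the good sign, [cross] loses [4 Phi], and Cauchy-Schwarz with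
    [tau <= 12 / N] gives [Y^2 tau <= 12 Phi], a loss of [3 Phi]; doubled, this is [14 Phi]. The
    error term uses [2 |y v| <= y v ^+ 2 + 1]. *)
Let sum_yG : - (80 * kap * (Phi + N) + 14 * Phi) <= 2 * \sum_(v in A) y v * G v.
Proof.
have h1 : \sum_(v in A) y v * (3 * t * y v + C v - Y * tau / 4) - \sum_(v in A) (40 * kap * (y v ^+ 2 + 1))
    <= \sum_(v in A) y v * G v.
  rewrite -sumrB; apply: ler_sum => v _; have := G_approx v.
  move: (y v) (G v) (3 * t * y v + C v - Y * tau / 4) kap kap0 => z g g' k k0.
  rewrite ler_norml => /andP[gg1 gg2].
  case: (lerP 0 z) => z0.
    have a1 : 0 <= z * (80 * k + (g - g')) by apply: mulr_ge0; lra.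
    have a2 : 0 <= k * (z - 1) ^+ 2 by apply: mulr_ge0; [exact: ltW | exact: sqr_ge0].
    by move: a2; rewrite !expr2; lra.
  have a1 : 0 <= (- z) * (80 * k - (g - g')) by apply: mulr_ge0; lra.
  have a2 : 0 <= k * (z + 1) ^+ 2 by apply: mulr_ge0; [exact: ltW | exact: sqr_ge0].
  by move: a2; rewrite !expr2; lra.
apply: le_trans (ler_wpM2l _ h1) => //.
have -> : \sum_(v in A) y v * (3 * t * y v + C v - Y * tau / 4)
   = 3 * t * Phi + \sum_(v in A) y v * C v - Y * Y * tau / 4.
  have -> : Y * Y * tau / 4 = \sum_(v in A) y v * (Y * tau / 4).
    by rewrite -mulr_suml -/Y !mulrA.
  rewrite /Phi mulr_sumr -big_split /= -sumrB.
  by apply: eq_bigr => v _; move: (y v) (C v) Y t tau => *; ring.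
have -> : \sum_(v in A) 40 * kap * (y v ^+ 2 + 1) = 40 * kap * (Phi + #|A|%:R).
  by rewrite -mulr_sumr big_split sumr_const.
have Y2 : Y * Y * tau <= 12 * Phi.
  have := sqr_sum_le A y; rewrite -/Y -/Phi expr2 => YY.
  case/andP: tau_bounds => tau0 tau1.
  apply: (@le_trans _ _ (N * Phi * (12 * N^-1))).
    apply: ler_pM => //; first by rewrite -expr2 sqr_ge0.
    by apply: le_trans YY _; apply: ler_wpM2r.
  by rewrite mulrC -mulrA mulKf // gt_eqF.
have tP : 0 <= t * Phi by apply: mulr_ge0.
have kA : kap * #|A|%:R <= kap * N by apply: ler_wpM2l => //; exact: ltW.
have := cross.
move: (\sum_(v in A) y v * C v) => c hc.
move: Phi0 Y2 tP kA hc; rewrite -[3 * t * Phi]mulrA.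
move: Phi Y t tau (#|A|%:R : R) => P Y' t' tau' a; lra.
Qed.

Let L_bounds e v : e \in F -> v \notin e -> 0 <= L e v <= 4 * kap.
Proof.
move=> eF ve; apply/andP; split.
  by apply: mulr_ge0; [exact: ltW | apply: sumr_ge0].
apply: (@le_trans _ _ (\sum_(u in e) kap)); last by rewrite sumr_const F4 // mulr_natl.
apply: (@le_trans _ _ (\sum_(u in e) h * \sum_(f in E) '1[ (v \in f) && (u \in f) ])); last first.
  by apply: ler_sum => u ue; apply: codegE; apply: contraNneq ve => ->.
rewrite -mulr_sumr /L; apply: ler_wpM2l; first exact: ltW.
rewrite exchange_big /=; apply: le_trans (ler_sumF _); last first.
  by move=> f; apply: sumr_ge0.
apply: ler_sum => f _; case vf: (v \in f) => /=; last by apply: sumr_ge0.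
case: (boolP [disjoint f & e]) => /= [_|/pred0Pn[u /= /andP[uf ue]]]; first by apply: sumr_ge0.
by rewrite (bigD1 u) //= uf lerDl; apply: sumr_ge0.
Qed.

(** Each new deviation is [y v - (L e v - tau)]. The linear terms of its square add up to the sum in
    [sum_yG]; the quadratic ones are at most [(12 kap)^2], with total weight at most [N^2] since
    [hW] and [#|A|] are at most [N]. Vertices of [e] merely leave the sum. *)
Lemma sum_discrepancyD :
  h * \sum_(e in edges_in A) discrepancy (A :\: e)
  <= h * #|edges_in A|%:R * discrepancy A + 14 * discrepancy A
     + 80 * kap * (discrepancy A + N) + 144 * (kap * N) ^+ 2.
Proof.
rewrite -/F -/hW -[discrepancy A]/Phi.
have step e : e \in F -> discrepancy (A :\: e) <=
    \sum_(v in A) (y v ^+ 2 - 2 * (y v * ('1[ v \notin e ] * (L e v - tau))) + 144 * kap ^+ 2).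
  move=> eF; rewrite /discrepancy big_mkcond [leRHS]big_mkcond /=; apply: ler_sum => v _.
  case: ifP => vAe; last first.
    case: ifP => vA //; have -> : v \in e by move: vAe; rewrite inE vA andbT => /negbFE.
    rewrite mul0r !mulr0 subr0; apply: addr_ge0; first exact: sqr_ge0.
    by apply: mulr_ge0 => //; exact: sqr_ge0.
  case/setDP: (vAe) => vA ve; rewrite vA ve (wdegD eF vAe) (tgtD eF) mul1r.
  have -> : x v - L e v - (t - tau) = y v - (L e v - tau) by rewrite /y; ring.
  have Lt : (L e v - tau) ^+ 2 <= 144 * kap ^+ 2.
    have := L_bounds eF ve; case/andP: tau_bounds; have := invNkap.
    move: (L e v) tau kap kap0 => l r k k0 kN r0 r1 /andP[l0 l1].
    have : 0 <= (12 * k - (l - r)) * (12 * k + (l - r)) by apply: mulr_ge0; lra.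
    by rewrite !expr2; lra.
  have -> : (y v - (L e v - tau)) ^+ 2 =
     y v ^+ 2 - 2 * (y v * (L e v - tau)) + (L e v - tau) ^+ 2 by ring.
  by rewrite lerD2l.
have : h * \sum_(e in F) discrepancy (A :\: e) <= h * \sum_(e in F)
    \sum_(v in A) (y v ^+ 2 - 2 * (y v * ('1[ v \notin e ] * (L e v - tau))) + 144 * kap ^+ 2).
  by apply: ler_wpM2l; [exact: ltW | apply: ler_sum].
move/le_trans; apply.
have -> : h * \sum_(e in F)
    \sum_(v in A) (y v ^+ 2 - 2 * (y v * ('1[ v \notin e ] * (L e v - tau))) + 144 * kap ^+ 2)
  = hW * Phi - 2 * (\sum_(v in A) y v * G v) + hW * #|A|%:R * (144 * kap ^+ 2).
  have -> : \sum_(v in A) y v * G v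
     = h * \sum_(e in F) \sum_(v in A) y v * ('1[ v \notin e ] * (L e v - tau)).
    rewrite exchange_big mulr_sumr /=; apply: eq_bigr => v _.
    rewrite -mulr_sumr mulrCA; congr (_ * _).
    rewrite /G; have -> : (hW - x v) * tau = h * \sum_(e in F) '1[ v \notin e ] * tau.
      rewrite /hW /x /wdeg -mulrBr -mulrA -sum1_card natr_sum -sumrB mulr_suml.
      by congr (_ * _); apply: eq_bigr => e _; case: (v \in e) => /=; rewrite ?subrr ?subr0.
    rewrite /S -mulrBr -sumrB; congr (_ * _).
    by apply: eq_bigr => e _; rewrite -mulrBr.
  have -> : \sum_(e in F) \sum_(v in A)
      (y v ^+ 2 - 2 * (y v * ('1[ v \notin e ] * (L e v - tau))) + 144 * kap ^+ 2)
    = #|F|%:R * (Phi + #|A|%:R * (144 * kap ^+ 2))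
      - 2 * \sum_(e in F) \sum_(v in A) y v * ('1[ v \notin e ] * (L e v - tau)).
    rewrite -[X in X%:R * (Phi + _)]sum1_card natr_sum mulr_suml mulr_sumr -sumrB.
    apply: eq_bigr => e _; rewrite big_split /= sumrB sumr_const -mulr_sumr.
    by rewrite -[_ *+ #|A|]mulr_natl mul1r addrAC.
  rewrite /hW; ring.
have hWA : hW * #|A|%:R * (144 * kap ^+ 2) <= 144 * (kap * N) ^+ 2.
  have -> : 144 * (kap * N) ^+ 2 = N * N * (144 * kap ^+ 2) by ring.
  apply: ler_wpM2r; first by apply: mulr_ge0 => //; exact: sqr_ge0.
  by apply: ler_pM => //; apply: mulr_ge0 => //; exact: ltW.
move: hWA sum_yG.
move: (\sum_(v in A) y v * G v) (hW * #|A|%:R * (144 * kap ^+ 2)) (144 * (kap * N) ^+ 2).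
move: Phi => P s w w' hs; lra.
Qed.

End OneStep.

(** Some edge does no worse than the average in [sum_discrepancyD], an increase of at most
    [(15 Phi + c) / hW]. Adding [c] to the discrepancy makes this a growth by a factor, where
    [hW >= eps^4 N / 8] and [120 = 15 * 8]. *)
Lemma nibble_step (R : realFieldType) (V : finType) (E : {set {set V}}) (h kap N eps : R)
    (A : {set V}) :
  (forall e, e \in E -> #|e| = 4%N) -> 0 < h -> 1 <= N -> 1 <= kap * N ->
  (forall u v, u != v -> h * \sum_(e in E) '1[ (u \in e) && (v \in e) ] <= kap) ->
  (forall v, h * \sum_(e in E) '1[ v \in e ] <= 4) ->
  80 * kap <= 1 -> 0 < eps -> #|A|%:R <= N -> (4 <= #|A|)%N -> eps * N <= #|A|%:R ->
  discrepancy E h N A <= eps ^+ 8 * N / 4 ->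
  let c := 80 * (kap * N) + 144 * (kap * N) ^+ 2 in
  exists2 e, e \in edges_in E A &
    discrepancy E h N (A :\: e) + c
      <= (discrepancy E h N A + c) * (1 + 120 / eps ^+ 4 / N).
Proof.
move=> E4 h0 N1 kN codegE degE kap1 eps0 AN A4 epsA PhiA c.
have N0 : 0 < N by lra.
have kap0 : 0 < kap by rewrite -(pmulr_lgt0 _ N0); lra.
have := sum_discrepancyD E4 h0 N1 kN codegE degE AN A4.
set Phi := discrepancy E h N A in PhiA *; set F := edges_in E A; set hW : R := h * #|F|%:R.
have Phi0 : 0 <= Phi by apply: sumr_ge0 => v _; apply: sqr_ge0.
move=> hsum.
have e40 : 0 < eps ^+ 4 by apply: exprn_gt0.
have hWl : eps ^+ 4 * N / 8 <= hW.
  pose p : R := #|A|%:R / N.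
  have pe : eps <= p by rewrite /p ler_pdivlMr.
  have pe4 : eps ^+ 4 <= p ^+ 4 by rewrite lerXn2r // nnegrE; lra.
  have pN : #|A|%:R = p * N by rewrite /p mulfVK // gt_eqF.
  have p1 : p <= 1 by rewrite /p ler_pdivrMr; lra.
  (* By completing the square, [w >= q - r/4 - (w - q)^2 / r] with [r = eps ^+ 4], so a small
     discrepancy prevents the total degree from falling far below [#|A| p^3]. *)
  have : \sum_(v in A) (p ^+ 3 - eps ^+ 4 / 4 - (wdeg E h A v - p ^+ 3) ^+ 2 / eps ^+ 4) <= 4 * hW.
    rewrite /hW (sum_wdeg h E4 A); apply: ler_sum => v _.
    move: (wdeg E h A v) (p ^+ 3) (eps ^+ 4) e40 => w q r r0.
    have : 0 <= ((w - q) / r + 1 / 2) ^+ 2 * r by apply: mulr_ge0; [exact: sqr_ge0 | exact: ltW].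
    have -> : ((w - q) / r + 1 / 2) ^+ 2 * r = (w - q) ^+ 2 / r + (w - q) + r / 4.
      by field; rewrite gt_eqF.
    lra.
  have PhiE : \sum_(v in A) (wdeg E h A v - p ^+ 3) ^+ 2 = Phi by [].
  rewrite sumrB sumr_const -mulr_suml PhiE -[_ *+ #|A|]mulr_natl pN.
  have -> : p * N * (p ^+ 3 - eps ^+ 4 / 4) = p ^+ 4 * N - p * (N * (eps ^+ 4 / 4)) by ring.
  have h1 : p * (N * (eps ^+ 4 / 4)) <= N * (eps ^+ 4 / 4).
    by rewrite ler_piMl //; apply: mulr_ge0; lra.
  have h2 : eps ^+ 4 * N <= p ^+ 4 * N by apply: ler_wpM2r; lra.
  have h3 : Phi / eps ^+ 4 <= eps ^+ 4 * N / 4.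
    rewrite ler_pdivrMr //; apply: le_trans PhiA _.
    have -> : eps ^+ 4 * N / 4 * eps ^+ 4 = eps ^+ 8 * N / 4 by field.
    exact: lexx.
  lra.
have hW0 : 0 < hW by apply: lt_le_trans hWl; apply: divr_gt0 => //; apply: mulr_gt0.
have c0 : 0 <= c.
  have := sqr_ge0 (kap * N); rewrite /c; have := mulr_ge0 (ltW kap0) (ltW N0); lra.
pose be := Phi + (15 * Phi + c) / hW.
have [e eF le_be] : exists2 e, e \in F & discrepancy E h N (A :\: e) <= be.
  case: (boolP [exists e in F, discrepancy E h N (A :\: e) <= be]).
    by case/exists_inP => e eF he; exists e.
  rewrite negb_exists_in => /forall_inP hall.
  have : h * \sum_(e in F) be < h * \sum_(e in F) discrepancy E h N (A :\: e).
    rewrite ltr_pM2l //; apply: ltr_sum; last by move=> e eF; rewrite ltNge hall.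
    apply/hasP; move: hW0; rewrite /hW pmulr_rgt0 // ltr0n card_gt0 => /set0Pn[e eF].
    by exists e; rewrite ?mem_index_enum.
  rewrite sumr_const -mulr_natl mulrA -/hW /be mulrDr [hW * (_ / _)]mulrC divfK ?gt_eqF //.
  have : 80 * kap * Phi <= Phi by rewrite ler_piMl.
  by move: hsum; rewrite /c -/hW; move: (h * \sum_(e in F) _) => s; lra.
exists e => //; apply: (@le_trans _ _ (be + c)); first by rewrite lerD2r.
have hq : (15 * Phi + c) / hW <= (Phi + c) * (120 / eps ^+ 4 / N).
  rewrite ler_pdivrMr //.
  have -> : (Phi + c) * (120 / eps ^+ 4 / N) * hW = (15 * Phi + 15 * c) * (hW / (eps ^+ 4 * N / 8)).
    by field; rewrite !gt_eqF.
  apply: (@le_trans _ _ (15 * Phi + 15 * c)); first by lra.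
  rewrite ler_peMr; first by []; first by lra.
  by rewrite ler_pdivlMr ?mul1r //; apply: divr_gt0 => //; apply: mulr_gt0.
rewrite /be; lra.
Qed.

(** [m] is the induction bound and [j] the number of steps done. As [j + #|A| <= n0] persists,
    [q ^+ j] never exceeds [q ^+ n0], and the discrepancy stays small enough for [nibble_step] until
    [A] has at most [eps N] vertices. *)
Lemma nibble_loop (R : realFieldType) (V : finType) (E : {set {set V}}) (h kap eps b : R) (n0 : nat) :
  let N : R := n0%:R in
  (forall e, e \in E -> #|e| = 4%N) -> 0 < h -> 1 <= N -> 1 <= kap * N ->
  (forall u v, u != v -> h * \sum_(e in E) '1[ (u \in e) && (v \in e) ] <= kap) ->
  (forall v, h * \sum_(e in E) '1[ v \in e ] <= 4) ->
  80 * kap <= 1 -> 0 < eps -> 4 <= eps * N ->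
  let c := 80 * (kap * N) + 144 * (kap * N) ^+ 2 in
  let q := 1 + 120 / eps ^+ 4 / N in
  0 <= b -> b * q ^+ n0 <= eps ^+ 8 * N / 4 ->
  forall m j (A : {set V}), (#|A| <= m)%N -> (j + #|A| <= n0)%N ->
  discrepancy E h N A + c <= b * q ^+ j ->
  exists2 X : {set V}, X \subset A & matchable E X /\ #|A :\: X|%:R <= eps * N.
Proof.
move=> N E4 h0 N1 kN codegE degE kap1 eps0 epsN c q b0 bq.
have q1 : 1 <= q.
  by rewrite /q lerDl divr_ge0 ?divr_ge0 ?exprn_ge0 //; lra.
have kap0 : 0 < kap by rewrite -(@pmulr_lgt0 _ N); lra.
have c0 : 0 <= c.
  have := sqr_ge0 (kap * N); rewrite /c; have : 0 <= kap * N by lra.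
  lra.
elim=> [|m IH] j A Am jA PhiA.
  exists set0; rewrite ?sub0set //; split; first exact: matchable0.
  move: Am; rewrite setD0 leqn0 => /eqP ->; lra.
have [small|big] := lerP #|A|%:R (eps * N).
  by exists set0; rewrite ?sub0set ?setD0 //; split => //; exact: matchable0.
have AN : #|A|%:R <= N by rewrite ler_nat; apply: leq_trans jA; apply: leq_addl.
have A4 : (4 <= #|A|)%N by rewrite -(ler_nat R); lra.
have PhiA' : discrepancy E h N A <= eps ^+ 8 * N / 4.
  have : b * q ^+ j <= b * q ^+ n0.
    apply: ler_wpM2l => //; apply: ler_weXn2l => //.
    by apply: leq_trans jA; apply: leq_addr.
  lra.
have [e eF he] := nibble_step E4 h0 N1 kN codegE degE kap1 eps0 AN A4 (ltW big) PhiA'.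
have [eE eA] : e \in E /\ e \subset A by move: eF; rewrite inE => /andP[].
have cA : (#|A :\: e| + 4 = #|A|)%N.
  by rewrite -(E4 e eE) -(cardsID e A) (setIidPr eA) addnC.
have [X XA [mX hX]] : exists2 X : {set V}, X \subset A :\: e & matchable E X /\ #|(A :\: e) :\: X|%:R <= eps * N.
  apply: (IH j.+1); [by rewrite -ltnS; apply: leq_trans Am; rewrite -cA addnS ltnS leq_addr
    | by apply: leq_trans jA; rewrite -cA addSnnS leq_add2l addnS ltnS leq_addr |].
  have -> : b * q ^+ j.+1 = b * q ^+ j * q by rewrite exprSr mulrA.
  apply: le_trans he _; apply: ler_wpM2r PhiA; exact: le_trans ler01 q1.
exists (e :|: X).
  by rewrite subUset eA; apply: subset_trans XA (subsetDl _ _).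
split; last by rewrite -setDDl.
apply: matchableU mX; last exact: matchable1.
by rewrite disjoint_sym; move: XA; rewrite subsetD => /andP[].
Qed.

(** All steps together multiply the discrepancy (plus [c]) by at most [(1 + B/N)^N <= exp B], a
    bound free of [N]. [eta] depends on [eps] alone, so that [K] may be chosen afterwards in terms
    of [eta]; only [n1] depends on [K]. *)
Lemma near_perfect_matching (R : realType) (eps : R) : 0 < eps ->
  exists2 eta : R, 0 < eta & forall K : R, 1 <= K ->
  exists n1 : nat, forall (V : finType) (E : {set {set V}}) (h : R) (A : {set V}),
  (n1 <= #|A|)%N -> (forall e, e \in E -> #|e| = 4%N) -> 0 < h ->
  (forall u v, u != v ->
     h * \sum_(e in E) '1[ (u \in e) && (v \in e) ] <= K / #|A|%:R) ->
  (forall v, h * \sum_(e in E) '1[ v \in e ] <= 4) ->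
  discrepancy E h #|A|%:R A <= eta * #|A|%:R ->
  exists2 X : {set V}, X \subset A & matchable E X /\ #|A :\: X|%:R <= eps * #|A|%:R.
Proof.
move=> eps0.
pose B : R := 120 / eps ^+ 4.
have B0 : 0 <= B by rewrite divr_ge0 // exprn_ge0 // ltW.
pose eB : R := sequences.expR B.
have eB0 : 0 < eB by apply: exp.expR_gt0.
have e80 : 0 < eps ^+ 8 by apply: exprn_gt0.
(* Chosen so that [2 * eta * eB = eps ^+ 8 / 4], the bound allowed in [nibble_step]; the factor 2
   makes room for [c <= eta * N]. *)
pose eta : R := eps ^+ 8 / 8 / eB.
have eta0 : 0 < eta by rewrite !divr_gt0.
exists eta => // K K1.
pose c : R := 80 * K + 144 * K ^+ 2.
have c0 : 0 <= c by have := sqr_ge0 K; rewrite /c; lra.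
pose n1 := (Num.bound (4 / eps) + Num.bound (80 * K) + Num.bound (c / eta))%N.
exists n1 => V E h A An1 E4 h0 codegE degE Phi0.
set N : R := #|A|%:R.
have n1N : n1%:R <= N by rewrite ler_nat.
have b1 : 4 / eps <= (Num.bound (4 / eps))%:R by apply/ltW/archi_boundP; rewrite divr_ge0 // ltW.
have b2 : 80 * K <= (Num.bound (80 * K))%:R by apply/ltW/archi_boundP; lra.
have b3 : c / eta <= (Num.bound (c / eta))%:R by apply/ltW/archi_boundP; rewrite divr_ge0 // ltW.
move: n1N; rewrite /n1 !natrD => n1N.
have z1 : 0 <= (Num.bound (4 / eps))%:R :> R by [].
have z2 : 0 <= (Num.bound (80 * K))%:R :> R by [].
have z3 : 0 <= (Num.bound (c / eta))%:R :> R by [].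
have N80 : 80 * K <= N by lra.
have N0 : 0 < N by lra.
have kN : K / N * N = K by rewrite divfK // gt_eqF.
have epsN : 4 <= eps * N.
  have : 4 / eps <= N by lra.
  by rewrite ler_pdivrMr // mulrC.
have cN : c <= eta * N.
  have : c / eta <= N by lra.
  by rewrite ler_pdivrMr // mulrC.
apply: (@nibble_loop R V E h (K / N) eps (2 * (eta * N)) #|A| E4 h0 _ _ codegE degE _ eps0 epsN _ _ #|A| 0%N).
- by rewrite -/N; lra.
- by rewrite -/N kN.
- by rewrite mulrA ler_pdivrMr // mul1r.
- by apply: mulr_ge0 => //; apply: mulr_ge0; exact: ltW.
- rewrite -/N -/B.
  have hq : (1 + B / N) ^+ #|A| <= eB.
    apply: (@le_trans _ _ (sequences.expR (B / N) ^+ #|A|)).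
      have BN : 0 <= B / N by rewrite divr_ge0 // ltW.
      apply: lerXn2r; rewrite ?nnegrE; [by rewrite addr_ge0 | exact/ltW/exp.expR_gt0 |].
      exact: exp.expR_ge1Dx.
    by rewrite -exp.expRM_natl mulrC -/N divfK // gt_eqF.
  apply: (@le_trans _ _ (2 * (eta * N) * eB)).
    by apply: ler_wpM2l => //; apply: mulr_ge0 => //; apply: mulr_ge0; exact: ltW.
  by rewrite /eta le_eqVlt; apply/orP; left; apply/eqP; field; rewrite gt_eqF.
- by [].
- by [].
- by rewrite -/N kN expr0 mulr1 -/c; lra.
Qed.

(** * A regular spanning subgraph *)

Section RegularSubgraph.
Variables (R : realFieldType) (V : finType) (E : {set {set V}}) (A : {set V}) (h : R).
Hypothesis E4 : forall e, e \in E -> #|e| = 4%N.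
Hypothesis EA : forall e, e \in E -> e \subset A.
Hypothesis h0 : 0 < h.

Definition residue (E' : {set {set V}}) v : R := 1 - h * \sum_(e in E') '1[ v \in e ].

Lemma residueU (E' : {set {set V}}) e v : e \notin E' -> residue (e |: E') v = residue E' v - h * '1[ v \in e ].
Proof. by move=> eE'; rewrite /residue big_setU1 //= mulrDr opprD addrCA addrC. Qed.

Lemma sum_set_sqrD (e : {set V}) (f : V -> R) (g : R) : e \in E ->
  \sum_(v in A) (f v + g * '1[ v \in e ]) ^+ 2
  = \sum_(v in A) f v ^+ 2 + 2 * g * \sum_(v in e) f v + 4 * g ^+ 2.
Proof.
move=> eE; have eA := EA eE.
have sumE (F : V -> R) : \sum_(v in e) F v = \sum_(v in A) '1[ v \in e ] * F v.
  rewrite big_mkcond [RHS]big_mkcond /=; apply: eq_bigr => v _.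
  case: ifP => [/(subsetP eA) -> | _]; first by rewrite mul1r.
  by rewrite mul0r; case: ifP.
have -> : 4 * g ^+ 2 = \sum_(v in e) g ^+ 2 by rewrite sumr_const E4 // mulr_natl.
rewrite !sumE mulr_sumr -!big_split /=; apply: eq_bigr => v _.
by case: (v \in e); rewrite /= ?mulr1 ?mulr0 ?mul1r ?mul0r ?addr0 //; ring.
Qed.

(* The cap 4 costs nothing: where it is tight the residue is about -3, and the other
   three vertices of an edge contribute at most 1 each. *)
Lemma regular_subgraph : exists E' : {set {set V}},
  [/\ E' \subset E, (forall v, h * \sum_(e in E') '1[ v \in e ] <= 4),
      (forall e, e \in E -> e \notin E' -> \sum_(v in e) residue E' v <= 2 * h) &
      \sum_(v in A) residue E' v ^+ 2
        <= \sum_(v in A) residue E' v + 2 * h * (h * #|E'|%:R)].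
Proof.
pose ok (E' : {set {set V}}) := (E' \subset E) && [forall v, h * \sum_(e in E') '1[ v \in e ] <= 4].
pose obj (E' : {set {set V}}) := \sum_(v in A) residue E' v ^+ 2.
have ok0 : ok set0.
  by rewrite /ok sub0set /=; apply/forallP => v; rewrite big_set0 mulr0.
case: (arg_minP obj ok0) => E' /andP[sE /forallP cap] objmin.
have capr v : -3 <= residue E' v by have := cap v; rewrite /residue; lra.
have r1 (E'' : {set {set V}}) v : residue E'' v <= 1.
  by rewrite /residue gerBl; apply: mulr_ge0; [exact: ltW | exact: sumr_ge0].
exists E'; split => //.
- move=> e eE eE'.
  (* Adding [e] changes the objective by [-2 h s + 4 h^2], which minimality makes nonnegative; if
     adding [e] is not allowed, it pushes some vertex of [e] over the cap. *)
  case: (boolP (ok (e |: E'))) => [/objmin|].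
    rewrite /obj; under [leRHS]eq_bigr do rewrite (residueU _ eE') -mulNr.
    rewrite sum_set_sqrD //; set s := \sum_(v in e) _; set o := \sum_(v in A) _ => le_o.
    have : 2 * h * s <= 2 * h * (2 * h) by move: le_o; rewrite !expr2; lra.
    by rewrite ler_pM2l //; apply: mulr_gt0.
  rewrite /ok subUset sub1set eE sE /= negb_forall => /existsP[v].
  rewrite -ltNge => hv.
  have ve : v \in e.
    apply: contraTT hv => ve; rewrite -leNgt big_setU1 //= (negbTE ve) add0r; exact: cap.
  have rv : residue E' v <= -3 + h.
    by move: hv; rewrite big_setU1 //= ve /residue mulrDr mulr1; lra.
  have c3 : #|e :\ v| = 3%N by have := cardsD1 v e; rewrite ve E4 //= add1n => -[<-].
  rewrite (big_setD1 v) //=.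
  have : \sum_(u in e :\ v) residue E' u <= \sum_(u in e :\ v) 1 by apply: ler_sum.
  rewrite sumr_const c3; move: (\sum_(u in _) _) rv h0 => s; lra.
- have rem e : e \in E' -> - (2 * h) <= \sum_(v in e) residue E' v.
    move=> eE'; have eE := subsetP sE e eE'.
    have eD : e \notin E' :\ e by rewrite !inE eqxx.
    have EU : E' = e |: (E' :\ e) by rewrite setD1K.
    have okD : ok (E' :\ e).
      rewrite /ok (subset_trans (subsetDl _ _) sE) /=; apply/forallP => v.
      apply: le_trans (cap v); apply: ler_wpM2l; first exact: ltW.
      by rewrite [in leRHS]EU big_setU1 //= lerDr.
    have := objmin _ okD; rewrite /obj.
    have -> : \sum_(v in A) residue (E' :\ e) v ^+ 2
       = \sum_(v in A) (residue E' v + h * '1[ v \in e ]) ^+ 2.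
      by apply: eq_bigr => v _; rewrite [in RHS]EU residueU // subrK.
    rewrite sum_set_sqrD //; set s := \sum_(v in e) _; set o := \sum_(v in A) _ => le_o.
    have : 2 * h * (- (2 * h)) <= 2 * h * s by move: le_o; rewrite !expr2; lra.
    by rewrite ler_pM2l //; apply: mulr_gt0.
  (* A residue [r] satisfies [r^2 = r - r (1 - r)], and [1 - r] is the weighted degree, so the
     second part becomes a sum over edges of [E']. By [rem] each edge sum is at least [-2h]. *)
  have -> : \sum_(v in A) residue E' v ^+ 2
     = \sum_(v in A) residue E' v - h * \sum_(e in E') \sum_(v in e) residue E' v.
    have -> : h * \sum_(e in E') \sum_(v in e) residue E' v
       = \sum_(v in A) residue E' v * (h * \sum_(e in E') '1[ v \in e ]).
      under [RHS]eq_bigr do rewrite mulrCA mulr_sumr.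
      rewrite -mulr_sumr exchange_big /=; congr (_ * _); apply: eq_bigr => e eE'.
      rewrite big_mkcond [RHS]big_mkcond /=; apply: eq_bigr => v _.
      case: ifP => [/(subsetP (EA (subsetP sE e eE'))) -> | _]; first by rewrite mulr1.
      by rewrite mulr0; case: ifP.
    rewrite -sumrB; apply: eq_bigr => v _.
    by rewrite expr2 {2}/residue mulrBr mulr1.
  have le_sum : - \sum_(e in E') \sum_(v in e) residue E' v <= 2 * h * #|E'|%:R.
    have -> : 2 * h * #|E'|%:R = - \sum_(e in E') (- (2 * h)).
      by rewrite sumrN opprK sumr_const mulr_natr.
    by rewrite lerN2; apply: ler_sum.
  have := ler_wpM2l (ltW h0) le_sum; rewrite lerD2l; lra.
Qed.

End RegularSubgraph.

Lemma sum_set4 (R : realFieldType) (V : finType) (f : V -> R) (a b c d : V) :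
  #|[set a; b; c; d]| = 4%N ->
  \sum_(v in [set a; b; c; d]) f v = f a + f b + f c + f d.
Proof.
pose s := [:: a; b; c; d].
have sE : [set a; b; c; d] =i s by move=> v; rewrite !inE -!orbA.
rewrite (eq_card sE) => c4; have su : uniq s by apply/card_uniqP.
by rewrite (eq_bigl _ _ sE) -(big_uniq _ su) /= !big_cons big_nil addr0 !addrA.
Qed.

Lemma codegree_le (V : finType) (E : {set {set V}}) (A : {set V}) u v :
  (forall e, e \in E -> #|e| = 4%N) -> (forall e, e \in E -> e \subset A) -> u != v ->
  (\sum_(e in E) ((u \in e) && (v \in e)) <= #|A| * #|A|)%N.
Proof.
move=> E4 EA uv; rewrite -big_mkcondr /= sum1_card.
rewrite -cardsX; apply: leq_trans _ (leq_imset_card (fun p : V * V => [set u; v; p.1; p.2]) (setX A A)).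
apply/subset_leq_card/subsetP => e /andP[eE /andP[ue ve]].
  have /cards2P[a [b [_ eab]]] : #|(e :\ u) :\ v| == 2%N.
    have c1 := cardsD1 u e; have c2 := cardsD1 v (e :\ u).
    move: c1 c2; rewrite !inE ue ve E4 // eq_sym uv /= !add1n => -[<-] -[<-].
    by [].
  have eE' : e = [set u; v; a; b].
    rewrite -[e in LHS](setD1K ue) -[e :\ u](@setD1K _ v); last by rewrite !inE eq_sym uv.
    by rewrite eab; apply/setP => w; rewrite !inE; case: (w == u); case: (w == v).
  apply/imsetP; exists (a, b) => //=; rewrite inE /=.
  have eA := subsetP (EA e eE).
by rewrite !eA // eE' !inE eqxx ?orbT.
Qed.

(** * The cover inequality in (1,3)-partite 4-graphs *)

Section OrderedEdges.
Variables (V : finType) (H : {set {set V}}).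

(** As edges have four elements, membership forces the four vertices to be distinct, so sums may
    range over all tuples. *)
Definition edge4 (u a b c : V) := [set u; a; b; c] \in H.

Lemma edge4C u a b c : edge4 u a b c -> edge4 u b a c.
Proof. by rewrite /edge4 -!setUA [ [set a] :|: _]setUCA. Qed.

Lemma edge4C' u a b c : edge4 u a b c -> edge4 u a c b.
Proof. by rewrite /edge4 -!setUA [ [set b] :|: _]setUC. Qed.

(* Ordered pairs, so this is twice the degree of {u, v}. *)
Definition link_deg (R : realFieldType) (P : {set V}) u v : R :=
  \sum_(b in P) \sum_(c in P) '1[ edge4 u v b c ].

End OrderedEdges.

Section FractionalCover13.
Variables (R : realFieldType) (V : finType) (H : {set {set V}}) (Q P : {set V}).
Variables (d h : R) (E' : {set {set V}}) (y : V -> R).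
Let n : R := #|P|%:R.

(** A tuple violating the inequality spans an edge of [E'], and an edge with four vertices accounts
    for at most [4^4 = 256] tuples. *)
Lemma bad_tuples_le :
  (forall e, e \in H -> #|e| = 4%N) ->
  (forall e, e \in H -> e \subset Q :|: P -> e \notin E' -> \sum_(v in e) y v <= 2 * h) ->
  (forall e, e \in E' -> #|e| = 4%N) ->
  \sum_(u in Q) \sum_(a in P) \sum_(b in P) \sum_(c in P)
     '1[ edge4 H u a b c && (2 * h < y u + y a + y b + y c) ] <= 256 * #|E'|%:R :> R.
Proof.
move=> H4 good E4.
apply: (@le_trans _ _ (\sum_(u in Q) \sum_(a in P) \sum_(b in P) \sum_(c in P)
   \sum_(e in E') '1[ u \in e ] * '1[ a \in e ] * ('1[ b \in e ] * '1[ c \in e ]))).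
  apply: ler_sum => u uQ; apply: ler_sum => a aP; apply: ler_sum => b bP; apply: ler_sum => c cP.
  case: (boolP (edge4 H u a b c)) => [Huabc|_] /=; last first.
    by apply: sumr_ge0 => e _; rewrite -!natrM.
  case: ltrP => hy; last by apply: sumr_ge0 => e _; rewrite -!natrM.
  have eE' : [set u; a; b; c] \in E'.
    apply: contraTT hy => eE'; rewrite -leNgt -sum_set4 ?H4 //; apply: good => //.
    by apply/subsetP => w; rewrite !inE -!orbA => /or4P[] /eqP ->; rewrite ?uQ ?aP ?bP ?cP ?orbT.
  rewrite (bigD1 _ eE') /= !inE !eqxx !orbT /= !mulr1 lerDl.
  by apply: sumr_ge0 => e _; rewrite -!natrM.
have sum4 (S : {set V}) e : e \in E' -> 0 <= (\sum_(v in S) '1[ v \in e ] : R) <= 4.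
  move=> eE'; rewrite sumr_ge0 //=; apply: (@le_trans _ _ (\sum_(v in e) 1)); last by rewrite sumr_const E4.
  rewrite big_mkcond [leRHS]big_mkcond /=; apply: ler_sum => v _.
  by case: (v \in e); case: (v \in S).
apply: (@le_trans _ _ (\sum_(e in E') 256)); last by rewrite sumr_const mulr_natr.
under eq_bigr do under eq_bigr do under eq_bigr do rewrite exchange_big /=.
under eq_bigr do under eq_bigr do rewrite exchange_big /=.
under eq_bigr do rewrite exchange_big /=.
rewrite exchange_big /=; apply: ler_sum => e eE'.
have -> : \sum_(u in Q) \sum_(a in P) \sum_(b in P) \sum_(c in P)
     '1[ u \in e ] * '1[ a \in e ] * ('1[ b \in e ] * '1[ c \in e ])
   = (\sum_(u in Q) '1[ u \in e ]) * (\sum_(a in P) '1[ a \in e ])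
     * ((\sum_(b in P) '1[ b \in e ]) * (\sum_(c in P) '1[ c \in e ])) :> R.
  rewrite -[X in _ = _ * X]sum_pairM !mulr_suml; apply: eq_bigr => u _.
  rewrite [X in _ = X * _]mulr_sumr mulr_suml; apply: eq_bigr => a _.
  by rewrite mulr_sumr; apply: eq_bigr => b _; rewrite mulr_sumr.
have := sum4 Q e eE'; have := sum4 P e eE'.
move: (\sum_(v in Q) _) (\sum_(v in P) _) => p q /andP[p0 p4] /andP[q0 q4].
have -> : 256 = 4 * 4 * (4 * 4) :> R by ring.
by apply: ler_pM; try apply: mulr_ge0 => //; apply: ler_pM.
Qed.

(** For fixed [u], spreading [y u - 2h] evenly over the other three vertices turns the edge
    inequality into that of a 3-graph, so [fractional_cover_le] applies. Summing over the [n/3]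
    vertices [u] gives the sums over [P] and over [Q] the same weight. *)
Lemma fractional_cover13_le :
  (forall e, e \in H -> #|e| = 4%N) -> (3 * #|Q|)%N = #|P| ->
  0 < d -> d <= 1 -> 0 < h -> h <= 1 ->
  (forall u v, u \in Q -> v \in P -> (1 / 3 + d) * n ^+ 2 <= link_deg H R P u v) ->
  (forall u v a b, u \in Q -> v \in P -> a \in P -> b \in P -> edge4 H u v a b ->
     (4 / 3 + d) * n ^+ 2 <= link_deg H R P u v + link_deg H R P u a) ->
  (forall e, e \in H -> e \subset Q :|: P -> e \notin E' -> \sum_(v in e) y v <= 2 * h) ->
  (forall e, e \in E' -> #|e| = 4%N) ->
  (forall v, -3 <= y v <= 1) ->
  (\sum_(v in P) y v + \sum_(v in Q) y v - 2 * h * n / 3) * (d ^+ 2 * n ^+ 3)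
    <= 384 * (256 * #|E'|%:R).
Proof.
move=> H4 QP d0 d1 h0 h1 dg1 dg2 good E4 yb.
have Qn : #|Q|%:R = n / 3 :> R by rewrite /n -QP natrM mulrAC divff ?mul1r // pnatr_eq0.
have hu u : u \in Q -> (\sum_(v in P) (y v + (y u - 2 * h) / 3)) * (d ^+ 2 * n ^+ 2)
   <= 128 * \sum_(a in P) \sum_(b in P) \sum_(c in P)
     '1[ edge4 H u a b c && (2 * h < y u + y a + y b + y c) ].
  move=> uQ.
  have := @fractional_cover_le R V P (edge4 H u) (@edge4C' _ H u) d
    (fun v => y v + (y u - 2 * h) / 3) d0 d1 (fun v => dg1 u v uQ) (fun v a b => dg2 u v a b uQ).
  move=> /(_ _)/le_trans -> //.
    by move=> v _; have := yb v; have := yb u; move: (y v) (y u) => s t; lra.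
  rewrite le_eqVlt; apply/orP; left; apply/eqP; congr (_ * _).
  apply: eq_bigr => a _; apply: eq_bigr => b _; apply: eq_bigr => c _.
  congr (nat_of_bool (_ && _))%:R.
  by apply/idP/idP; move: (y u) (y a) (y b) (y c) => *; lra.
have := bad_tuples_le H4 good E4.
set g := \sum_(u in Q) _ => gE.
have : (\sum_(u in Q) \sum_(v in P) (y v + (y u - 2 * h) / 3)) * (d ^+ 2 * n ^+ 2) <= 128 * g.
  by rewrite mulr_suml mulr_sumr; apply: ler_sum.
have -> : \sum_(u in Q) \sum_(v in P) (y v + (y u - 2 * h) / 3)
   = n / 3 * (\sum_(v in P) y v + \sum_(v in Q) y v - 2 * h * n / 3).
  under eq_bigr do rewrite big_split sum_const_set /=.
  rewrite big_split sum_const_set /= -mulr_sumr -mulr_suml sumrB sum_const_set Qn -/n.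
  by move: n (\sum_(v in P) _) (\sum_(v in Q) _) => m a b; field.
move: gE; move: g (\sum_(v in P) _ + _ - _) (#|E'|%:R : R) => G Y e.
by rewrite !exprS expr0; lra.
Qed.

End FractionalCover13.

(** * Almost perfect matchings of dense (1,3)-partite 4-graphs *)

Lemma residue_sum_arith (R : realFieldType) (Y h n d C eta e : R) :
  0 < h -> 0 < n -> 0 < eta -> 0 <= e ->
  (Y - 2 * h * n / 3) * (d ^+ 2 * n ^+ 3) <= 384 * (256 * e) ->
  h * n ^+ 3 = C -> h * e <= 4 / 3 * n -> 512 * 256 <= eta * (d ^+ 2 * C) -> 10 * h <= eta ->
  Y + 2 * h * (h * e) <= eta * (4 / 3 * n).
Proof.
move=> h0 n0 eta0 e0 hY hn he dC heta.
pose c0 : R := 512 * 256.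
have c00 : 0 < c0 by rewrite mulr_gt0.
(* Multiplying by [h] turns [h * n^3] into [C] and [h * e] into at most [4/3 n];
   [512 = 384 * 4/3]. *)
have {}hY : (Y - 2 * h * n / 3) * (d ^+ 2 * C) <= c0 * n.
  have := ler_wpM2l (ltW h0) hY.
  have -> : h * ((Y - 2 * h * n / 3) * (d ^+ 2 * n ^+ 3)) = (Y - 2 * h * n / 3) * (d ^+ 2 * (h * n ^+ 3)) by field.
  rewrite hn /c0; move: (_ * (d ^+ 2 * C)) => s; lra.
have Yn : Y - 2 * h * n / 3 <= eta * n.
  have [Y0|Y0] := lerP (Y - 2 * h * n / 3) 0.
    by apply: le_trans Y0 _; apply: mulr_ge0; exact: ltW.
  rewrite -(ler_pM2r c00).
  apply: (@le_trans _ _ (eta * ((Y - 2 * h * n / 3) * (d ^+ 2 * C)))); last first.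
    by rewrite -[eta * n * _]mulrA [n * _]mulrC; apply: ler_wpM2l hY; exact: ltW.
  move: (Y - 2 * h * n / 3) Y0 {hY} => Z Z0.
  by rewrite [eta * _]mulrCA; apply: ler_wpM2l dC; exact: ltW.
have hn' : h * n * 10 <= eta * n by rewrite mulrC mulrA; apply: ler_wpM2r; [exact: ltW|].
have := ler_wpM2l (ltW h0) he.
move: (h * e) => s; lra.
Qed.

(** With edge weight [h = C / n^3] the regular subgraph [E'] has at most [4/3 n^4 / C] edges, so for
    large [C] few tuples violate the cover inequality. The sum of the residues, and with it the sum
    of their squares, is then at most [eta #|A|], as [near_perfect_matching] requires. *)
Lemma dense_near_perfect (R : realType) (d eps : R) : 0 < d -> d <= 1 -> 0 < eps ->
  exists n2 : nat, forall (V : finType) (H : {set {set V}}) (Q P : {set V}),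
  [disjoint Q & P] -> (forall e, e \in H -> #|e| = 4%N) -> (3 * #|Q|)%N = #|P| ->
  (n2 <= #|P|)%N ->
  (forall u v, u \in Q -> v \in P -> (1 / 3 + d) * #|P|%:R ^+ 2 <= link_deg H R P u v) ->
  (forall u v a b, u \in Q -> v \in P -> a \in P -> b \in P -> edge4 H u v a b ->
     (4 / 3 + d) * #|P|%:R ^+ 2 <= link_deg H R P u v + link_deg H R P u a) ->
  exists2 X : {set V}, X \subset Q :|: P &
    matchable H X /\ #|(Q :|: P) :\: X|%:R <= eps * #|Q :|: P|%:R.
Proof.
move=> d0 d1 eps0.
have [eta eta0 near] := near_perfect_matching eps0.
pose c0 : R := 512 * 256.
have c00 : 0 < c0 by rewrite mulr_gt0.
pose C : R := c0 / (d ^+ 2 * eta) + 1.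
have de0 : 0 < d ^+ 2 * eta by rewrite mulr_gt0 // exprn_gt0.
have C1 : 1 <= C by rewrite lerDr divr_ge0 // ltW.
have [|n1 hn1] := near (3 * C); first by lra.
exists (n1 + Num.bound C + Num.bound (10 * C / eta))%N => V H Q P QP H4 QP3 nP dg1 dg2.
set A := Q :|: P; set n : R := #|P|%:R in dg1 dg2.
have AE : #|A|%:R = 4 / 3 * n :> R.
  rewrite /A cardsU (disjoint_setI0 QP) cards0 subn0 natrD /n -QP3 natrM; lra.
have AP : (#|P| <= #|A|)%N by apply/subset_leq_card/subsetUr.
have nb : (n1 + Num.bound C + Num.bound (10 * C / eta))%:R <= n by rewrite ler_nat.
have b2 : C <= (Num.bound C)%:R by apply/ltW/archi_boundP; apply: le_trans C1.
have b3 : 10 * C / eta <= (Num.bound (10 * C / eta))%:R.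
  apply/ltW/archi_boundP; apply: divr_ge0; last exact: ltW.
  by apply: mulr_ge0 => //; exact: le_trans C1.
move: nb; rewrite !natrD => nb.
have [z1 z2 z3] : [/\ 0 <= n1%:R :> R, 0 <= (Num.bound C)%:R :> R & 0 <= (Num.bound (10 * C / eta))%:R :> R] by [].
have nC : C <= n by lra.
have n10 : 10 * C <= eta * n.
  have : 10 * C / eta <= n by lra.
  by rewrite ler_pdivrMr // [n * _]mulrC.
have n1' : 1 <= n by apply: le_trans nC.
have n0 : 0 < n by apply: lt_le_trans n1'.
have A0 : 0 < #|A|%:R :> R by rewrite AE mulr_gt0 // divr_gt0.
have n30 : 0 < n ^+ 3 by apply: exprn_gt0.
pose h : R := C / n ^+ 3.
have hn : h * n ^+ 3 = C by rewrite /h divfK // gt_eqF.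
have C0 : 0 < C by apply: lt_le_trans C1.
have h0 : 0 < h by apply: divr_gt0.
have hCn : h * n <= C.
  rewrite -hn; apply: ler_wpM2l; first exact: ltW.
  by rewrite exprS; apply: ler_peMr; [exact: ltW | exact: exprn_ege1].
have h1 : h <= 1.
  rewrite -(ler_pM2r n0) mul1r; apply: le_trans nC; exact: hCn.
have heta : 10 * h <= eta.
  rewrite -(ler_pM2r n0); apply: le_trans n10; rewrite -mulrA.
  exact: ler_wpM2l.
pose E := edges_in H A.
have EH : E \subset H by apply/subsetP => e; rewrite inE => /andP[].
have EA e : e \in E -> e \subset A by rewrite inE => /andP[].
have E4 e : e \in E -> #|e| = 4%N by move=> /(subsetP EH); exact: H4.
have [E' [sE cap good res]] := regular_subgraph E4 EA h0.
have E'A e : e \in E' -> e \subset A by move=> /(subsetP sE); exact: EA.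
have E'4 e : e \in E' -> #|e| = 4%N by move=> /(subsetP sE); exact: E4.
have E'E : edges_in E' A = E'.
  by apply/setP => e; rewrite inE; case: (boolP (e \in E')) => //= /E'A.
have hE' : h * #|E'|%:R <= #|A|%:R.
  have := sum_wdeg h E'4 A; rewrite E'E.
  have : \sum_(v in A) wdeg E' h A v <= \sum_(v in A) 4.
    by apply: ler_sum => v _; rewrite /wdeg E'E.
  by rewrite sumr_const -[4 *+ _]mulr_natr => /(le_trans _)h4 h5; rewrite -(ler_pM2l (ltr0n R 4)) h4 // h5.
have yb v : -3 <= residue h E' v <= 1.
  rewrite /residue; have := cap v.
  have : 0 <= h * \sum_(e in E') '1[ v \in e ] by apply: mulr_ge0; [exact: ltW | exact: sumr_ge0].
  by move: (h * _) => s s0 s4; clear -s0 s4; lra.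
have [X XA [mX hX]] : exists2 X : {set V}, X \subset A & matchable E' X /\ #|A :\: X|%:R <= eps * #|A|%:R.
  apply: (hn1 V E' h A) => //.
  - apply: leq_trans AP; apply: leq_trans nP; rewrite -addnA; exact: leq_addr.
  - move=> u v uv; rewrite ler_pdivlMr //.
    have cd := codegree_le E'4 E'A uv.
    have {}cd : \sum_(e in E') '1[ (u \in e) && (v \in e) ] <= #|A|%:R * #|A|%:R :> R.
      by rewrite -natr_sum -natrM ler_nat.
    have := ler_wpM2l (ltW h0) cd; rewrite AE => {}cd.
    have := ler_wpM2r (ltW n0) cd.
    have -> : h * (4 / 3 * n * (4 / 3 * n)) * n = 16 / 9 * (h * n ^+ 3) by field.
    rewrite hn; move: (h * \sum_(e in E') _) => s hs.
    rewrite mulrCA [s * _]mulrC; clear -hs C0; lra.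
  (* The process starts from all of [A], so the target degree is 1 and the discrepancy is the sum of
     the squared residues. *)
  - have -> : discrepancy E' h #|A|%:R A = \sum_(v in A) residue h E' v ^+ 2.
      rewrite /discrepancy /wdeg E'E divff ?expr1n; last by rewrite gt_eqF.
      by apply: eq_bigr => v _; rewrite /residue -sqrrN opprB.
    apply: le_trans res _.
    have goodH e : e \in H -> e \subset Q :|: P -> e \notin E' -> \sum_(v in e) residue h E' v <= 2 * h.
      by move=> eH eA; apply: good; rewrite inE eH.
    have := fractional_cover13_le H4 QP3 d0 d1 h0 h1 dg1 dg2 goodH E'4 yb.
    rewrite -/n.
    have -> : \sum_(v in A) residue h E' v = \sum_(v in P) residue h E' v + \sum_(v in Q) residue h E' v.
      rewrite (eq_bigl [predU Q & P]); last by move=> v; rewrite !inE.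
      by rewrite bigU //= addrC.
    move=> hY; rewrite AE; apply: (residue_sum_arith h0 n0 eta0 _ hY hn _ _ heta) => //; first by rewrite -AE.
    have -> : eta * (d ^+ 2 * C) = c0 + d ^+ 2 * eta.
      rewrite mulrA [LHS]mulrC [eta * _]mulrC.
      by rewrite {1}/C mulrDl divfK ?gt_eqF // mul1r.
    by rewrite lerDl ltW.
by exists X => //; split => //; apply: matchableS mX; apply: subset_trans EH.
Qed.

(** * Absorption *)

Section Links.
Variables (R : realType) (V : finType) (H : {set {set V}}) (Q P : {set V}) (d : R).
Let n : R := #|P|%:R.
Hypothesis d0 : 0 < d.
Hypothesis d12 : d <= 1 / 2.
Hypothesis Qn : #|Q|%:R = n / 3 :> R.
Hypothesis n0 : 0 < n.
Hypothesis dg1 : forall u v, u \in Q -> v \in P -> (1 / 3 + d) * n ^+ 2 <= link_deg H R P u v.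
Hypothesis dg2 : forall u v a b, u \in Q -> v \in P -> a \in P -> b \in P -> edge4 H u v a b ->
  (4 / 3 + d) * n ^+ 2 <= link_deg H R P u v + link_deg H R P u a.
Implicit Types u v w : V.

Let n20 : 0 < n ^+ 2. Proof. exact: exprn_gt0. Qed.

Let card_sum (S : {set V}) : S \subset P -> \sum_(b in P) '1[ b \in S ] = #|S|%:R :> R.
Proof.
move=> /subsetP sS; rewrite -sum1_card natr_sum big_mkcond [RHS]big_mkcond /=.
by apply: eq_bigr => b _; case: ifP; case: ifP => // /sS ->.
Qed.

(** The threshold is half of the lower bound on degree sums, so of two vertices adjacent in the link
    of [u] at least one belongs to it. *)
Definition big_link u := [set v in P | (2 / 3 + d / 2) * n ^+ 2 <= link_deg H R P u v].

(** The link of a vertex [s] outside [B] consists of pairs within [B]. The two members of a link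
    pair of a neighbour [a] of [s] are adjacent, hence the pair meets [B]. The two degrees add up to
    at most [|B|^2 + (2n|B| - |B|^2) = 2n|B|], against the lower bound [4/3 n^2]. *)
Lemma card_big_link u : u \in Q -> 2 / 3 * n <= #|big_link u|%:R.
Proof.
move=> uQ; set B := big_link u.
have BP : B \subset P by apply/subsetP => v; rewrite inE => /andP[].
have notB v : v \in P -> v \notin B -> link_deg H R P u v < (2 / 3 + d / 2) * n ^+ 2.
  by move=> vP; rewrite inE vP /= -ltNge.
have [PB|/subsetPn[s sP sB]] := boolP (P \subset B).
  have : n <= #|B|%:R by rewrite ler_nat subset_leq_card.
  by move: n0; lra.
have inB v a b : v \in P -> a \in P -> b \in P -> edge4 H u v a b -> v \notin B -> a \in B.
  move=> vP aP bP Hu vB; apply: contraT => aB.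
  have := notB v vP vB; have := notB a aP aB; have := dg2 uQ vP aP bP Hu; lra.
have [a aP [b bP Hsab]] : exists2 a, a \in P & exists2 b, b \in P & edge4 H u s a b.
  have [/exists_inP[a aP /exists_inP[b bP Hsab]]|] := boolP [exists a in P, [exists b in P, edge4 H u s a b]].
    by exists a => //; exists b.
  rewrite negb_exists_in => /forall_inP nex.
  have := dg1 uQ sP; rewrite /link_deg big1 => [|a aP]; last first.
    apply: big1 => b bP; have := nex a aP; rewrite negb_exists_in => /forall_inP/(_ b bP).
    by move=> /negbTE ->.
  have : 0 < (1 / 3 + d) * n ^+ 2 by apply: mulr_gt0 => //; move: d0; lra.
  by move=> h1 h2; lra.
have ls : link_deg H R P u s <= #|B|%:R * #|B|%:R.
  rewrite -(card_sum BP) -sum_pairM; apply: ler_sum_pair => b' c bP' cP.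
  case Hs: (edge4 H u s b' c) => /=; last by rewrite -natrM.
  by rewrite (inB s b' c) // (inB s c b') ?mulr1 // edge4C'.
have la : link_deg H R P u a <= 2 * n * #|B|%:R - #|B|%:R * #|B|%:R.
  have -> : 2 * n * #|B|%:R - #|B|%:R * #|B|%:R =
     \sum_(b in P) \sum_(c in P) (('1[ b \in B ] + '1[ c \in B ]) - '1[ b \in B ] * '1[ c \in B ]) :> R.
    under eq_bigr do rewrite sumrB.
    by rewrite sumrB sum_pairD sum_pairM (card_sum BP) -/n; lra.
  apply: ler_sum_pair => b' c bP' cP.
  case Hs: (edge4 H u a b' c) => /=.
    case bB: (b' \in B); case cB: (c \in B) => /=; rewrite ?mulr1 ?mul0r ?mulr0; try lra.
    by have := inB b' c a bP' cP aP; rewrite bB cB => /(_ (edge4C' (edge4C Hs)) isT).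
  by case bB: (b' \in B); case cB: (c \in B) => /=; rewrite ?mulr1 ?mul0r ?mulr0; lra.
have : 4 / 3 * n ^+ 2 <= 2 * n * #|B|%:R.
  by have := dg2 uQ sP aP bP Hsab; have : 0 <= d * n ^+ 2 by [apply: mulr_ge0; exact: ltW]; lra.
rewrite expr2 => hB; rewrite -(ler_pM2r n0); lra.
Qed.

Definition adj u v w := [exists b in P, edge4 H u v w b].

Definition robust_nbr v := [set w in P | d / 24 * n <= \sum_(u in Q) '1[ adj u v w ]].

(** A link with [n^2/3] ordered pairs spans at least [n / sqrt 3] vertices, and [kap] is
    [1 / sqrt 3]. Summed over [u], the vertices outside [N] contribute at most [d/24 n^2], whence
    the loss [d/8]. *)
Lemma card_robust_nbr (kap : R) v : 0 <= kap -> kap ^+ 2 = 1 / 3 -> v \in P ->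
  (kap - d / 8) * n <= #|robust_nbr v|%:R.
Proof.
move=> kap0 kap2 vP; set N := robust_nbr v.
have NP : N \subset P by apply/subsetP => w; rewrite inE => /andP[].
have Du u : u \in Q -> kap * n <= \sum_(w in P) '1[ adj u v w ].
  move=> uQ; set D := \sum_(w in P) _.
  have D0 : 0 <= D by apply: sumr_ge0.
  have : link_deg H R P u v <= D * D.
    rewrite /D -sum_pairM; apply: ler_sum_pair => b c bP cP.
    case Hs: (edge4 H u v b c) => /=; last by rewrite -natrM.
    have -> : adj u v b by apply/exists_inP; exists c.
    have -> : adj u v c by apply/exists_inP; exists b => //; exact: edge4C'.
    by rewrite mulr1.
  have := dg1 uQ vP => l1 l2; rewrite leNgt; apply/negP => hD.
  have kn : 0 <= kap * n by apply: mulr_ge0 => //; exact: ltW.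
  have : D * D <= (kap * n) * (kap * n) by apply: ler_pM => //; exact: ltW.
  have -> : (kap * n) * (kap * n) = kap ^+ 2 * n ^+ 2 by ring.
  rewrite kap2; have : 0 < d * n ^+ 2 by apply: mulr_gt0.
  by move: l1 l2; lra.
have h1 : (n / 3) * (kap * n) <= \sum_(w in P) \sum_(u in Q) '1[ adj u v w ].
  rewrite exchange_big /= -Qn -sum_const_set; exact: ler_sum.
have h2 : \sum_(w in P) \sum_(u in Q) '1[ adj u v w ] <= \sum_(w in P) (n / 3 * '1[ w \in N ] + d / 24 * n).
  apply: ler_sum => w wP; case wN: (w \in N) => /=.
    apply: (@le_trans _ _ (\sum_(u in Q) 1)).
      by apply: ler_sum => u _; rewrite lern1 leq_b1.
    rewrite sumr_const Qn mulr1 lerDl; apply: mulr_ge0; last exact: ltW.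
    by move: d0; lra.
  by rewrite mulr0 add0r; move: wN; rewrite inE wP /= => /negbT; rewrite -ltNge => /ltW.
move: h2; rewrite big_split /= -mulr_sumr (card_sum NP) sum_const_set -/n => h2.
rewrite -(ler_pM2r n0); move: (le_trans h1 h2); rewrite -(@ler_pM2l _ 3) //; lra.
Qed.

(** When [v] and [w] are adjacent in the link of [u], their degrees there add up to at least [n^2/3]
    more than the number [n^2] of all pairs, so at least [n^2/3] pairs are common. *)
Lemma common_link_ge v w : v \in P -> w \in robust_nbr v ->
  d / 72 * n ^+ 3 <= \sum_(u in Q) \sum_(a in P) \sum_(b in P) '1[ edge4 H u v a b && edge4 H u w a b ].
Proof.
move=> vP; rewrite inE => /andP[wP hw].
apply: (@le_trans _ _ (\sum_(u in Q) '1[ adj u v w ] * (n ^+ 2 / 3))).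
  rewrite -mulr_suml; apply: (@le_trans _ _ (d / 24 * n * (n ^+ 2 / 3))); last first.
    by apply: ler_wpM2r hw; apply: divr_ge0 => //; exact: ltW.
  by rewrite le_eqVlt; apply/orP; left; apply/eqP; field.
apply: ler_sum => u uQ; case: (boolP (adj u v w)) => [/exists_inP[b bP Hb]|_] /=; last first.
  by rewrite mul0r; apply: sumr_ge0 => a _; apply: sumr_ge0.
rewrite mul1r; have := dg2 uQ vP wP bP Hb => hs.
have dn : 0 <= d * n ^+ 2 by apply: mulr_ge0; exact: ltW.
apply: (@le_trans _ _ (link_deg H R P u v + link_deg H R P u w - \sum_(a in P) \sum_(b in P) 1)).
  by under eq_bigr do rewrite sum_const_set mulr1; rewrite sum_const_set -/n -expr2; lra.
rewrite /link_deg -big_split -sumrB /=; apply: ler_sum => a _.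
rewrite -big_split -sumrB /=; apply: ler_sum => c _.
by case: (edge4 H u v a c); case: (edge4 H u w a c) => /=; lra.
Qed.

(** At least [(1/2 + 2/3 - 1) n = n/6] vertices [w1] of [big_link u] are robust neighbours of [v1].
    The link of such a [w1] has density at least [2/3 + d/2], and the pairs of robust neighbours of
    [v2] and [v3] have density at least [1/3 - d/4], so they share [d/4 n^2] pairs. *)
Lemma robust_triple_ge u v1 v2 v3 : u \in Q -> v1 \in P -> v2 \in P -> v3 \in P ->
  d / 24 * n ^+ 3 <= \sum_(w1 in P) \sum_(w2 in P) \sum_(w3 in P)
    '1[ [&& edge4 H u w1 w2 w3, w1 \in robust_nbr v1, w2 \in robust_nbr v2 & w3 \in robust_nbr v3] ].
Proof.
move=> uQ v1P v2P v3P.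
pose kap : R := Num.sqrt (1 / 3).
have kap0 : 0 <= kap by apply: sqrtr_ge0.
have kap2 : kap ^+ 2 = 1 / 3 by rewrite sqr_sqrtr // divr_ge0.
(* [9/16] leaves [1/2] after subtracting [d/8 <= 1/16]. *)
have kap9 : 9 / 16 <= kap.
  rewrite leNgt; apply/negP => hk.
  have : kap ^+ 2 <= 9 / 16 * (9 / 16) by rewrite expr2; apply: ler_pM => //; exact: ltW.
  rewrite kap2; lra.
have kap1 : kap <= 1.
  rewrite leNgt; apply/negP => hk.
  have : 1 * 1 <= kap ^+ 2 by rewrite expr2; apply: ler_pM => //; exact: ltW.
  rewrite kap2; lra.
have N1 := card_robust_nbr kap0 kap2 v1P.
have N2 := card_robust_nbr kap0 kap2 v2P.
have N3 := card_robust_nbr kap0 kap2 v3P.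
have NP v : robust_nbr v \subset P by apply/subsetP => w; rewrite inE => /andP[].
have BP : big_link u \subset P by apply/subsetP => w; rewrite inE => /andP[].
have Bu := card_big_link uQ.
have kd : 1 / 2 <= kap - d / 8 by move: d12; lra.
have N23 : (1 / 3 - d / 4) * n ^+ 2 <= #|robust_nbr v2|%:R * #|robust_nbr v3|%:R.
  apply: (@le_trans _ _ (((kap - d / 8) * n) * ((kap - d / 8) * n))); last first.
    by apply: ler_pM => //; apply: mulr_ge0; [lra | exact: ltW | lra | exact: ltW].
  have -> : ((kap - d / 8) * n) * ((kap - d / 8) * n) = (kap ^+ 2 - kap * d / 4 + (d / 8) ^+ 2) * n ^+ 2 by field.
  apply: ler_wpM2r; first exact: ltW.
  rewrite kap2; have := sqr_ge0 (d / 8).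
  have : kap * d <= d by rewrite ler_piMl // ltW.
  lra.
have card_w1 : n / 6 <= \sum_(w in P) '1[ (w \in robust_nbr v1) && (w \in big_link u) ].
  apply: (@le_trans _ _ (\sum_(w in P) ('1[ w \in robust_nbr v1 ] + '1[ w \in big_link u ] - 1))).
    rewrite sumrB big_split /= (card_sum (NP v1)) (card_sum BP) sum_const_set mulr1 -/n.
    have := ler_wpM2r (ltW n0) kd; lra.
  by apply: ler_sum => w _; case: (w \in robust_nbr v1); case: (w \in big_link u) => /=; lra.
apply: (@le_trans _ _ (n / 6 * (d / 4 * n ^+ 2))).
  by rewrite le_eqVlt; apply/orP; left; apply/eqP; field.
have dn2 : 0 <= d / 4 * n ^+ 2 by rewrite mulr_ge0 ?divr_ge0 ?ltW.
apply: le_trans (ler_wpM2r dn2 card_w1) _.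
rewrite mulr_suml; apply: ler_sum => w1 w1P.
case wN: (w1 \in robust_nbr v1) => /=; last first.
  by rewrite mul0r; apply: sumr_ge0 => w2 _; apply: sumr_ge0.
case: (boolP (w1 \in big_link u)) => [|_] /=; last first.
  by rewrite mul0r; apply: sumr_ge0 => w2 _; apply: sumr_ge0.
rewrite inE w1P mul1r /= => hl.
apply: (@le_trans _ _ (link_deg H R P u w1
   + \sum_(w2 in P) \sum_(w3 in P) '1[ w2 \in robust_nbr v2 ] * '1[ w3 \in robust_nbr v3 ]
   - \sum_(w2 in P) \sum_(w3 in P) 1)).
  rewrite sum_pairM !card_sum //.
  under [X in _ - X]eq_bigr do rewrite sum_const_set mulr1.
  by rewrite sum_const_set -/n -expr2; lra.
rewrite /link_deg -big_split -sumrB /=; apply: ler_sum => w2 _.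
rewrite -big_split -sumrB /=; apply: ler_sum => w3 _.
by case: (edge4 H u w1 w2 w3); case: (w2 \in robust_nbr v2); case: (w3 \in robust_nbr v3);
  rewrite /= ?mulr1 ?mulr0 ?mul0r; lra.
Qed.

End Links.

(** * Absorber tuples and their number *)

Definition dep_pairs (A B : finType) (S : {set A}) (F : A -> {set B}) :=
  [set p : A * B | (p.1 \in S) && (p.2 \in F p.1)].

Lemma card_dep_pairs (R : realFieldType) (A B : finType) (S : {set A}) (F : A -> {set B}) (k m : R) :
  0 <= m -> k <= #|S|%:R -> (forall a, a \in S -> m <= #|F a|%:R) ->
  k * m <= #|dep_pairs S F|%:R.
Proof.
move=> m0 kS mF.
have -> : #|dep_pairs S F| = (\sum_(a in S) #|F a|)%N.
  rewrite -sum1_card; under [RHS]eq_bigr do rewrite -sum1_card.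
  by rewrite pair_big_dep /=; apply: eq_bigl => p; rewrite inE.
apply: le_trans (ler_wpM2r m0 kS) _; rewrite natr_sum mulr_natl -sumr_const.
exact: ler_sum.
Qed.

Lemma card_set3 (R : realFieldType) (V : finType) (A B C : {set V}) (p : V -> V -> V -> bool) :
  #|[set s : V * V * V | [&& s.1.1 \in A, s.1.2 \in B, s.2 \in C & p s.1.1 s.1.2 s.2]]|%:R
  = \sum_(a in A) \sum_(b in B) \sum_(c in C) '1[ p a b c ] :> R.
Proof.
rewrite -sum1_card natr_sum pair_big pair_big /=.
rewrite big_mkcond [RHS]big_mkcond /=; apply: eq_bigr => s _.
by rewrite inE; case: (_ \in A); case: (_ \in B); case: (_ \in C); case: (p _ _ _).
Qed.

Lemma card_set4_uniq (V : finType) (a b c d : V) :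
  #|[set a; b; c; d]| = 4%N -> uniq [:: a; b; c; d].
Proof.
have sE : [set a; b; c; d] =i [:: a; b; c; d] by move=> v; rewrite !inE -!orbA.
by rewrite (eq_card sE) => c4; apply/card_uniqP.
Qed.

Lemma uniq_cat4 (T : eqType) (s0 s1 s2 s3 : seq T) :
  uniq s0 -> uniq s1 -> uniq s2 -> uniq s3 ->
  all [predC s0] s1 -> all [predC s0] s2 -> all [predC s0] s3 ->
  all [predC s1] s2 -> all [predC s1] s3 -> all [predC s2] s3 ->
  uniq (s0 ++ s1 ++ s2 ++ s3).
Proof.
move=> u0 u1 u2 u3; rewrite !all_predC => n01 n02 n03 n12 n13 n23.
rewrite !cat_uniq u0 u1 u2 u3 !has_cat !negb_or.
by rewrite n01 n02 n03 n12 n13 n23.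
Qed.

Lemma set_seq_cat (T : finType) (s1 s2 : seq T) :
  [set y in s1 ++ s2] = [set y in s1] :|: [set y in s2].
Proof. by apply/setP => y; rewrite !inE mem_cat. Qed.

Section Tuples.
Variable V : finType.
Implicit Types (s w : V * V * V) (Z : {set V}).

Definition tseq s := [:: s.1.1; s.1.2; s.2].

Definition avoid (S : {set V * V * V}) Z := [set s in S | all (fun v => v \notin Z) (tseq s)].

Lemma card_avoid (R : realFieldType) (S : {set V * V * V}) Z :
  #|S|%:R - 3 * #|Z|%:R * #|V|%:R ^+ 2 <= #|avoid S Z|%:R :> R.
Proof.
pose Z1 := setX (setX Z [set: V]) [set: V].
pose Z2 := setX (setX [set: V] Z) [set: V].
pose Z3 := setX (setX [set: V] [set: V]) Z.
have sub : S \subset avoid S Z :|: (Z1 :|: (Z2 :|: Z3)).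
  apply/subsetP => s sS; rewrite !inE sS /= !andbT.
  by case: (s.1.1 \in Z); case: (s.1.2 \in Z); case: (s.2 \in Z).
have c1 : #|Z1| = (#|Z| * #|V| ^ 2)%N by rewrite !cardsX cardsT -mulnA.
have c2 : #|Z2| = (#|Z| * #|V| ^ 2)%N by rewrite !cardsX cardsT mulnC mulnA mulnC.
have c3 : #|Z3| = (#|Z| * #|V| ^ 2)%N by rewrite !cardsX cardsT mulnC.
have le1 : (#|S| <= #|avoid S Z| + (#|Z1| + (#|Z2| + #|Z3|)))%N.
  apply: leq_trans (subset_leq_card sub) _.
  apply: leq_trans (leq_card_setU _ _) _; rewrite leq_add2l.
  apply: leq_trans (leq_card_setU _ _) _; rewrite leq_add2l.
  exact: leq_card_setU.
move: le1; rewrite c1 c2 c3 -(ler_nat R) !natrD natrM natrX; lra.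
Qed.

End Tuples.

Section Absorbers.
Variables (V : finType) (H : {set {set V}}) (Q P : {set V}).
Variable N : V -> {set V}.
Hypothesis H4 : forall e, e \in H -> #|e| = 4%N.
Implicit Types (s w : V * V * V) (Z : {set V}).

Definition switches v v' :=
  [set s : V * V * V | [&& s.1.1 \in Q, s.1.2 \in P, s.2 \in P &
    edge4 H s.1.1 v s.1.2 s.2 && edge4 H s.1.1 v' s.1.2 s.2]].

Definition targets u v1 v2 v3 :=
  [set w : V * V * V | [&& w.1.1 \in P, w.1.2 \in P, w.2 \in P &
    [&& edge4 H u w.1.1 w.1.2 w.2, w.1.1 \in N v1, w.1.2 \in N v2 & w.2 \in N v3]]].

Definition after Z s := Z :|: [set y in tseq s].

(* A tuple (w, s1, s2, s3): the triple w completes u to an edge, and each s_i completes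
   both v_i and w_i; the sets Z, w, s1, s2, s3 are disjoint. *)
Definition absorbers u v1 v2 v3 Z : {set V * V * V * (V * V * V) * (V * V * V) * (V * V * V)} :=
  dep_pairs (dep_pairs (dep_pairs (avoid (targets u v1 v2 v3) Z)
    (fun w => avoid (switches v1 w.1.1) (after Z w)))
    (fun t => avoid (switches v2 t.1.1.2) (after (after Z t.1) t.2)))
    (fun t => avoid (switches v3 t.1.1.2) (after (after (after Z t.1.1) t.1.2) t.2)).

Definition tlist (t : V * V * V * (V * V * V) * (V * V * V) * (V * V * V)) :=
  tseq t.1.1.1 ++ tseq t.1.1.2 ++ tseq t.1.2 ++ tseq t.2.

Lemma edge4_uniq u a b c : edge4 H u a b c -> uniq [:: u; a; b; c].
Proof. by move=> /H4; exact: card_set4_uniq. Qed.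

Lemma matchable_edge4 u a b c : edge4 H u a b c -> matchable H [set y in [:: u; a; b; c]].
Proof.
move=> /matchable1; have -> // : [set u; a; b; c] = [set y in [:: u; a; b; c]].
by apply/setP => y; rewrite !inE -!orbA.
Qed.

Lemma matchable_cat (s1 s2 : seq V) : uniq (s1 ++ s2) ->
  matchable H [set y in s1] -> matchable H [set y in s2] -> matchable H [set y in s1 ++ s2].
Proof.
rewrite cat_uniq set_seq_cat => /and3P[_ dis _] m1 m2.
apply: matchableU => //; apply/pred0P => y /=; rewrite !inE; apply: contraNF dis.
by move=> /andP[y1 y2]; apply/hasP; exists y.
Qed.

Lemma mem_avoid S Z s : s \in avoid S Z -> s \in S /\ all (fun v => v \notin Z) (tseq s).
Proof. by rewrite inE => /andP. Qed.

Lemma all_after Z s s' : all (fun v => v \notin after Z s) (tseq s') ->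
  all (fun v => v \notin Z) (tseq s') /\ all (fun v => v \notin tseq s) (tseq s').
Proof.
move=> h; split; apply: sub_all h => v; rewrite !inE negb_or => /andP[] //.
Qed.

Lemma uniq_perm_matchable (s1 s2 : seq V) : perm_eq s1 s2 ->
  uniq s1 -> (uniq s2 -> matchable H [set y in s2]) -> matchable H [set y in s1].
Proof.
move=> p u m; have -> : [set y in s1] = [set y in s2].
  by apply/setP => y; rewrite !inE (perm_mem p).
by apply: m; rewrite -(perm_uniq p).
Qed.

(** Alone, the twelve vertices split into the three edges [{u_i, a_i, b_i, w_i}]; with [u], [v1],
    [v2], [v3] added they split into [{u, w1, w2, w3}] and the edges [{u_i, a_i, b_i, v_i}]. *)
Lemma absorbersP u v1 v2 v3 Z t : t \in absorbers u v1 v2 v3 Z ->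
  [/\ all (fun v => v \notin Z) (tlist t), uniq (tlist t), matchable H [set y in tlist t] &
      uniq (tlist t ++ [:: u; v1; v2; v3]) ->
      matchable H [set y in tlist t ++ [:: u; v1; v2; v3]]].
Proof.
case: t => [[[[[w1 w2] w3] [[u1 a1] b1]] [[u2 a2] b2]] [[u3 a3] b3]].
rewrite inE => /andP[]; rewrite inE => /andP[]; rewrite inE => /andP[].
move=> /mem_avoid[t0 z0] /mem_avoid[t1 z1] /mem_avoid[t2 z2] /mem_avoid[t3 z3].
move: t0 t1 t2 t3; rewrite !inE /=.
move=> /and5P[_ _ _ eu _] /and5P[_ _ _ e1 f1] /and5P[_ _ _ e2 f2] /and5P[_ _ _ e3 f3].
have [z1' d1] := all_after z1.
have [/all_after[z2' d2] d2'] := all_after z2.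
have [/all_after[/all_after[z3' d3] d3'] d3''] := all_after z3.
have toEnd u' v' a' b' : edge4 H u' v' a' b' -> edge4 H u' a' b' v' by move=> e; apply/edge4C'/edge4C.
have aZ : all (fun v => v \notin Z) (tlist (w1, w2, w3, (u1, a1, b1), (u2, a2, b2), (u3, a3, b3))).
  by rewrite /tlist !all_cat z0 z1' z2' z3'.
have U : uniq (tlist (w1, w2, w3, (u1, a1, b1), (u2, a2, b2), (u3, a3, b3))).
  have tl (x a b c : V) : uniq [:: x; a; b; c] -> uniq [:: a; b; c] by case/andP.
  have hd (a b c x : V) : uniq [:: x; a; b; c] -> uniq [:: x; b; c].
    by rewrite /= !inE !negb_or => /and3P[/and3P[_ -> ->] _ ->].
  apply: uniq_cat4 => //; [exact: tl (edge4_uniq eu) | exact: hd (edge4_uniq e1)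
    | exact: hd (edge4_uniq e2) | exact: hd (edge4_uniq e3)].
split => //.
- apply: (uniq_perm_matchable (s2 := [:: u1; a1; b1; w1] ++ [:: u2; a2; b2; w2] ++ [:: u3; a3; b3; w3])) => //.
    apply/permP => p /=; move:
      (nat_of_bool (p u1)) (nat_of_bool (p a1)) (nat_of_bool (p b1)) (nat_of_bool (p u2))
      (nat_of_bool (p a2)) (nat_of_bool (p b2)) (nat_of_bool (p u3)) (nat_of_bool (p a3))
      (nat_of_bool (p b3)) (nat_of_bool (p w1)) (nat_of_bool (p w2)) (nat_of_bool (p w3)).
    by clear => *; lia.
  move=> U'; apply: matchable_cat => //; first exact/matchable_edge4/toEnd.
  move: U'; rewrite cat_uniq => /and3P[_ _ U'].
  by apply: matchable_cat => //; apply/matchable_edge4/toEnd.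
- move=> UU; apply: (uniq_perm_matchable
    (s2 := [:: u; w1; w2; w3] ++ [:: u1; a1; b1; v1] ++ [:: u2; a2; b2; v2] ++ [:: u3; a3; b3; v3])) => //.
    apply/permP => p /=; move:
      (nat_of_bool (p u1)) (nat_of_bool (p a1)) (nat_of_bool (p b1)) (nat_of_bool (p u2))
      (nat_of_bool (p a2)) (nat_of_bool (p b2)) (nat_of_bool (p u3)) (nat_of_bool (p a3))
      (nat_of_bool (p b3)) (nat_of_bool (p w1)) (nat_of_bool (p w2)) (nat_of_bool (p w3))
      (nat_of_bool (p u)) (nat_of_bool (p v1)) (nat_of_bool (p v2)) (nat_of_bool (p v3)).
    by clear => *; lia.
  move=> U'; apply: matchable_cat => //; first exact/matchable_edge4.
  move: U'; rewrite cat_uniq => /and3P[_ _ U'].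
  apply: matchable_cat => //; first exact/matchable_edge4/toEnd.
  move: U'; rewrite cat_uniq => /and3P[_ _ U'].
  by apply: matchable_cat => //; apply/matchable_edge4/toEnd.
Qed.

Lemma card_after Z s : (#|after Z s| <= #|Z| + 3)%N.
Proof.
apply: leq_trans (leq_card_setU _ _) _; rewrite leq_add2l cardsE.
exact: (card_size (tseq s)).
Qed.

(** The four triples are chosen in turn. Nine vertices have been used before the last choice, and a
    forbidden set of size [#|Z| + 9] spoils at most [3 (#|Z| + 9) #|V|^2] triples. *)
Lemma card_absorbers (R : realFieldType) (m : R) u v1 v2 v3 Z : 0 <= m ->
  m + 3 * (#|Z|%:R + 9) * #|V|%:R ^+ 2 <= #|targets u v1 v2 v3|%:R ->
  (forall v v', v \in [:: v1; v2; v3] -> v' \in N v ->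
     m + 3 * (#|Z|%:R + 9) * #|V|%:R ^+ 2 <= #|switches v v'|%:R) ->
  m ^+ 4 <= #|absorbers u v1 v2 v3 Z|%:R.
Proof.
move=> m0 mT mS.
have V2 : 0 <= #|V|%:R ^+ 2 :> R by rewrite exprn_ge0.
have avoid_ge (S : {set V * V * V}) Z' : (#|Z'| <= #|Z| + 9)%N -> m + 3 * (#|Z|%:R + 9) * #|V|%:R ^+ 2 <= #|S|%:R ->
    m <= #|avoid S Z'|%:R.
  move=> hZ hS; apply: le_trans (card_avoid _ S Z').
  have : #|Z'|%:R * #|V|%:R ^+ 2 <= (#|Z|%:R + 9) * #|V|%:R ^+ 2 :> R.
    by apply: ler_wpM2r => //; rewrite -natrD ler_nat.
  by move: hS; rewrite -[3 * _ * _]mulrA -[3 * #|Z'|%:R * _]mulrA; lra.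
have c1 Z' s : (#|after Z' s| <= #|Z'| + 3)%N := card_after Z' s.
rewrite 3!exprSr expr1 /absorbers; do 3 ?apply: card_dep_pairs => //.
- by apply: avoid_ge => //; apply: leq_addr.
- move=> w /mem_avoid[]; rewrite inE => /and5P[_ _ _ _ /and3P[N1 _ _]] _.
  apply: avoid_ge; last by apply: mS; rewrite ?inE ?eqxx.
  by apply: leq_trans (c1 _ _) _; rewrite leq_add2l.
- move=> t; rewrite inE => /andP[/mem_avoid[]]; rewrite inE => /and5P[_ _ _ _ /and3P[_ N2 _]] _ _.
  apply: avoid_ge; last by apply: mS; rewrite ?inE ?eqxx ?orbT.
  have := c1 (after Z t.1) t.2; have := c1 Z t.1.
  by move: #|_| #|_| #|_| => p q r; clear; lia.
- move=> t; rewrite inE => /andP[]; rewrite inE => /andP[/mem_avoid[]].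
  rewrite inE => /and5P[_ _ _ _ /and3P[_ _ N3]] _ _ _.
  apply: avoid_ge; last by apply: mS; rewrite ?inE ?eqxx ?orbT.
  have := c1 (after (after Z t.1.1) t.1.2) t.2; have := c1 (after Z t.1.1) t.1.2; have := c1 Z t.1.1.
  by move: #|_| #|_| #|_| #|_| => p q r x; clear; lia.
Qed.

End Absorbers.

(** * Choosing a disjoint absorbing family *)

Lemma weighted_pick (R : realFieldType) (I T : finType) (X : {set I}) (phi : I -> R)
    (G : I -> {set T}) (m : R) :
  X != set0 -> (forall x, x \in X -> 0 < phi x) -> 0 < m ->
  (forall x, x \in X -> m <= #|G x|%:R) ->
  exists t, m / #|T|%:R * \sum_(x in X) phi x <= \sum_(x in X) phi x * '1[ t \in G x ].
Proof.
move=> /set0Pn[x0 x0X] phi0 m0 mG.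
have [t0 _] : exists t0, t0 \in G x0.
  by apply/set0Pn; rewrite -card_gt0 -(ltr0n R); apply: lt_le_trans (mG x0 x0X).
have T0 : 0 < #|T|%:R :> R by rewrite ltr0n; apply/card_gt0P; exists t0.
have [/existsP[t ht]|] := boolP [exists t, m / #|T|%:R * \sum_(x in X) phi x <= \sum_(x in X) phi x * '1[ t \in G x ] ].
  by exists t.
rewrite negb_exists => /forallP hlt; exfalso.
(* If every [t] fell short, summing over [t] would contradict the double count in which each [x] is
   hit by at least [m] of them. *)
have : \sum_(t : T) \sum_(x in X) phi x * '1[ t \in G x ] < \sum_(t : T) m / #|T|%:R * \sum_(x in X) phi x.
  apply: ltr_sum => [|t _]; last by rewrite ltNge hlt.
  by apply/hasP; exists t0; rewrite ?mem_index_enum.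
have -> : \sum_(t : T) m / #|T|%:R * \sum_(x in X) phi x = m * \sum_(x in X) phi x.
  by rewrite sumr_const -[LHS]mulr_natr mulrAC divfK ?gt_eqF.
rewrite exchange_big /= ltNge mulr_sumr => /negP; apply; apply: ler_sum => x xX.
rewrite -mulr_sumr [leLHS]mulrC; apply: ler_wpM2l; first exact/ltW/phi0.
apply: le_trans (mG x xX) _; rewrite -sum1_card natr_sum big_mkcond /=.
by apply: ler_sum => t _; case: (t \in G x).
Qed.

(** Applied with the current weights, [pick] finds a set that absorbs a share [c] of the total
    weight; halving that share multiplies the total by at most [1 - c/2]. Before the last of [r]
    rounds at most [12 (r - 1)] vertices are covered, hence [zmax + 12]. *)
Lemma absorbing_family (R : realFieldType) (V I : finType) (X : {set I})
    (absorbs : {set V} -> I -> bool) (good : pred {set V}) (c : R) (zmax : nat) :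
  0 <= c -> c <= 2 ->
  (forall (Z : {set V}) (phi : I -> R), X != set0 -> (#|Z| <= zmax)%N ->
     (forall x, x \in X -> 0 < phi x) ->
     exists A : {set V}, [/\ A != set0, (#|A| <= 12)%N, [disjoint A & Z], good A &
       c * \sum_(x in X) phi x <= \sum_(x in X) phi x * '1[ absorbs A x ] ]) ->
  forall r, (12 * r <= zmax + 12)%N ->
  exists F : {set {set V}}, [/\ trivIset F, (#|cover F| <= 12 * r)%N,
    (forall A, A \in F -> good A) &
    \sum_(x in X) (1 / 2) ^+ #|[set A in F | absorbs A x]| <= #|X|%:R * (1 - c / 2) ^+ r].
Proof.
move=> c0 c2 pick; have [->|X0] := eqVneq X set0.
  move=> r _; exists set0; split.
  - by apply/trivIsetP => A B; rewrite inE.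
  - by rewrite /cover big_set0 cards0.
  - by move=> A; rewrite inE.
  - by rewrite big_set0 cards0 mul0r.
elim=> [|r IH] hr.
  exists set0; split.
  - by apply/trivIsetP => A B; rewrite inE.
  - by rewrite /cover big_set0 cards0.
  - by move=> A; rewrite inE.
  - rewrite expr0 mulr1 -sum1_card natr_sum; apply: ler_sum => x _.
    have -> : [set A in set0 | absorbs A x] = set0 by apply/setP => A; rewrite !inE.
    by rewrite cards0 expr0.
have [F [tF cF gF sF]] := IH ltac:(by move: hr; clear; lia).
(* An absorber of x halves the weight of x, so large total weight always marks the
   tuples that still lack absorbers. *)
pose phi x : R := (1 / 2) ^+ #|[set A in F | absorbs A x]|.
have phi0 x : x \in X -> 0 < phi x by move=> _; apply: exprn_gt0; rewrite divr_gt0.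
have [A [A0 A12 dA gA hA]] := pick (cover F) phi X0 ltac:(by move: hr cF; clear; lia) phi0.
have AF : A \notin F.
  apply: contraNN A0 => AF; move: dA.
  by rewrite /cover (bigD1 A) //= -setI_eq0 setIUr setIid setU_eq0 => /andP[].
exists (A |: F); split.
- apply/trivIsetP => B C /setU1P[->|BF] /setU1P[->|CF] BC.
  + by rewrite eqxx in BC.
  + by apply: disjointWr dA; apply: bigcup_sup CF.
  + by rewrite disjoint_sym; apply: disjointWr dA; apply: bigcup_sup BF.
  + exact: (trivIsetP tF).
- rewrite /cover big_setU1 //=; apply: leq_trans (leq_card_setU _ _) _.
  by rewrite mulnS; apply: leq_add.
- by move=> B /setU1P[->|/gF].
rewrite exprSr mulrA.
apply: (@le_trans _ _ (\sum_(x in X) (phi x - phi x * '1[ absorbs A x ] / 2))).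
  apply: ler_sum => x _; rewrite /phi.
  case hx: (absorbs A x) => /=.
    have -> : [set B in A |: F | absorbs B x] = A |: [set B in F | absorbs B x].
      by apply/setP => B; rewrite !inE; case: eqP => [->|].
    rewrite cardsU1 inE (negbTE AF) add1n exprS; move: (_ ^+ _) => p; lra.
  have -> : [set B in A |: F | absorbs B x] = [set B in F | absorbs B x].
    by apply/setP => B; rewrite !inE; case: eqP => [->|//]; rewrite hx !andbF.
  by rewrite mulr0 mul0r subr0.
rewrite sumrB -mulr_suml; have c1 : 0 <= 1 - c / 2 by lra.
have := ler_wpM2r c1 sF; move: hA; rewrite -/phi.
move: (\sum_(x in X) phi x) (\sum_(x in X) phi x * _) => s s'; move: (_ * (1 - c / 2)) => b; lra.
Qed.

Lemma matchable_cover (V : finType) (H F : {set {set V}}) :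
  trivIset F -> (forall A, A \in F -> matchable H A) -> matchable H (cover F).
Proof.
move: {2}#|F| (leqnn #|F|) => m; elim: m F => [|m IH] F.
  rewrite leqn0 cards_eq0 => /eqP -> _ _; rewrite /cover big_set0; exact: matchable0.
move=> Fm tF mF; have [->|/set0Pn[A AF]] := eqVneq F set0.
  rewrite /cover big_set0; exact: matchable0.
rewrite /cover (big_setD1 A) //=; apply: matchableU; last 1 first.
- apply: IH; last by move=> B /setD1P[_ /mF].
    by move: Fm; rewrite (cardsD1 A) AF.
  exact: trivIsetS (subsetDl _ _) tF.
- apply/pred0P => v /=; apply/negbTE/negP => /andP[vA /bigcupP[B /setD1P[BA BF] vB]].
  have := trivIsetP tF A B AF BF; rewrite eq_sym BA => /(_ isT)/pred0P/(_ v) /=.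
  by rewrite vA vB.
- exact: mF.
Qed.

Section AbsorbAll.
Variables (V : finType) (H : {set {set V}}) (Q P : {set V}).
Implicit Types x : V * V * V * V.

Definition quads := [set x : V * V * V * V |
  [&& x.1.1.1 \in Q, x.1.1.2 \in P, x.1.2 \in P, x.2 \in P & uniq [:: x.1.1.2; x.1.2; x.2] ] ].

Definition qlist x := [:: x.1.1.1; x.1.1.2; x.1.2; x.2].

(** A set meeting [x] satisfies this vacuously. That is harmless, since [absorb_all] only uses
    quadruples disjoint from every set of the family. *)
Definition absorbs (A : {set V}) x :=
  [disjoint A & [set y in qlist x]] ==> matchable H (A :|: [set y in qlist x]).

(** One vertex of [Q] and three of [P] are taken from [U] and given to one of their absorbers.
    Discarding that absorber lowers every count by at most one, which keeps pace with [j]. *)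
Lemma absorb_all j (F : {set {set V}}) (U : {set V}) : [disjoint Q & P] ->
  trivIset F -> (forall A, A \in F -> matchable H A) -> [disjoint cover F & U] ->
  U \subset Q :|: P -> #|U :&: Q| = j -> #|U :&: P| = (3 * j)%N ->
  (forall x, x \in quads -> (j <= #|[set A in F | absorbs A x]|)%N) ->
  matchable H (cover F :|: U).
Proof.
move=> QP; elim: j F U => [|j IH] F U tF mF dFU UQP UQ UP hF.
  have -> : U = set0.
    rewrite -(setIidPl UQP) setIUr.
    move: UQ UP; rewrite muln0 => /eqP; rewrite cards_eq0 => /eqP -> /eqP.
    by rewrite cards_eq0 => /eqP ->; rewrite setU0.
  by rewrite setU0; apply: matchable_cover.
have [u uUQ] : exists u, u \in U :&: Q by apply/card_gt0P; rewrite UQ.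
have /card_gt2P[v1 [v2 [v3 [[h1 h2 h3] [n12 n23 n31]]]]] : (2 < #|U :&: P|)%N.
  by rewrite UP mulnS; apply: leq_trans (leq_addr _ _).
case/setIP: uUQ => uU uQ; case/setIP: h1 => v1U v1P; case/setIP: h2 => v2U v2P; case/setIP: h3 => v3U v3P.
have uv v : v \in P -> (v == u) = false.
  move=> vP; apply/eqP => vu; move/pred0P: QP => /(_ u) /=.
  by rewrite uQ -vu vP.
pose x := (u, v1, v2, v3).
have xq : x \in quads.
  by rewrite inE uQ v1P v2P v3P /= !inE negb_or n12 n23 eq_sym n31.
set xs := [set y in qlist x].
have xsE v : (v \in xs) = [|| v == u, v == v1, v == v2 | v == v3] by rewrite !inE.
have xsU : xs \subset U.
  by apply/subsetP => v; rewrite !inE => /or4P[] /eqP ->.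
have [A] : exists A, A \in [set A in F | absorbs A x].
  by apply/card_gt0P; apply: leq_trans (hF x xq).
rewrite inE => /andP[AF absA].
have AU : [disjoint A & U] by apply: disjointWl dFU; apply: bigcup_sup AF.
have mAx : matchable H (A :|: xs).
  by move: absA; rewrite /absorbs (disjointWr xsU AU).
have cF : cover F = A :|: cover (F :\ A) by rewrite /cover (big_setD1 A).
have dF'U : [disjoint cover (F :\ A) & U].
  by apply: disjointWl dFU; rewrite cF subsetUr.
have dAF' : [disjoint A & cover (F :\ A)].
  apply/pred0P => v /=; apply/negbTE/negP => /andP[vA /bigcupP[B /setD1P[BA BF] vB]].
  have := trivIsetP tF A B AF BF; rewrite eq_sym BA => /(_ isT)/pred0P/(_ v) /=.
  by rewrite vA vB.
have mrest : matchable H (cover (F :\ A) :|: (U :\: xs)).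
  apply: IH.
  - exact: trivIsetS (subsetDl _ _) tF.
  - by move=> B /setD1P[_ /mF].
  - exact: disjointWr (subsetDl _ _) dF'U.
  - exact: subset_trans (subsetDl _ _) UQP.
  - have -> : (U :\: xs) :&: Q = (U :&: Q) :\ u.
      apply/setP => v; rewrite in_setI in_setD xsE in_setD1 in_setI.
      case vQ: (v \in Q); rewrite ?andbF // !andbT.
      have nv w : w \in P -> (v == w) = false.
        move=> wP; apply/eqP => vw; move/pred0P: QP => /(_ v) /=.
        by rewrite vQ vw wP.
      by rewrite (nv v1) // (nv v2) // (nv v3) //; case: (v == u).
    by have := cardsD1 u (U :&: Q); rewrite UQ inE uU uQ add1n => -[].
  - have -> : (U :\: xs) :&: P = (U :&: P) :\: [set v1; v2; v3].
      apply/setP => v; rewrite in_setI in_setD xsE in_setD in_setI !inE -!orbA.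
      by case vP: (v \in P); rewrite ?andbF // !andbT uv.
    have c3 : #|[set v1; v2; v3]| = 3%N.
      have u3 : uniq [:: v1; v2; v3] by rewrite /= !inE negb_or n12 n23 eq_sym n31.
      by rewrite -[RHS](card_uniqP u3); apply: eq_card => v; rewrite !inE -orbA.
    have := cardsID [set v1; v2; v3] (U :&: P).
    have -> : U :&: P :&: [set v1; v2; v3] = [set v1; v2; v3].
      apply/setIidPr/subsetP => v; rewrite !inE -orbA => /or3P[] /eqP ->; first by rewrite v1U.
        by rewrite v2U.
      by rewrite v3U.
    rewrite UP c3; clear; lia.
  - move=> y yq; have := hF y yq.
    have -> : [set B in F :\ A | absorbs B y] = [set B in F | absorbs B y] :\ A.
      by apply/setP => B; rewrite !inE andbA.
    by rewrite (cardsD1 A); case: (A \in _) => /=; [rewrite add1n | rewrite add0n => /ltnW].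
have -> : cover F :|: U = (A :|: xs) :|: (cover (F :\ A) :|: (U :\: xs)).
  apply/setP => v; rewrite cF !in_setU in_setD.
  have := subsetP xsU v.
  case: (v \in A); case: (v \in cover _); case: (v \in xs); case: (v \in U) => // /(_ isT) //.
apply: (matchableU _ mAx mrest).
have dxF : [disjoint xs & cover (F :\ A)].
  by rewrite disjoint_sym; exact: disjointWr xsU dF'U.
have dxU : [disjoint xs & U :\: xs].
  by apply/pred0P => v /=; rewrite in_setD; case: (v \in xs).
have dAU : [disjoint A & U :\: xs] by exact: disjointWr (subsetDl _ _) AU.
apply/pred0P => v /=; rewrite !in_setU.
move/pred0P/(_ v): dAF'; move/pred0P/(_ v): dxF; move/pred0P/(_ v): dxU; move/pred0P/(_ v): dAU => /=.
by case: (v \in A); case: (v \in xs); case: (v \in cover _); case: (v \in U :\: xs).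
Qed.

End AbsorbAll.

(** The ratio [m^4 / #|V|^12] for [m = d/144 n^3] and [#|V| = 4/3 n], a lower bound for the
    proportion of 12-tuples that absorb a given quadruple. *)
Definition absorber_density (R : realFieldType) (d : R) : R := (d / 144) ^+ 4 * (3 / 4) ^+ 12.

(** There are at least [d/72 n^3] candidates for each of the four triples, and at most half that
    many meet [Z] or an earlier triple. [weighted_pick] then selects a tuple absorbing a large share
    of the weight. *)
Lemma absorber_pick (R : realType) (V : finType) (H : {set {set V}}) (Q P : {set V}) (d : R)
    (Z : {set V}) (phi : V * V * V * V -> R) :
  let n : R := #|P|%:R in
  [disjoint Q & P] -> 0 < d -> d <= 1 / 2 -> #|Q|%:R = n / 3 :> R -> #|V|%:R = 4 / 3 * n -> 0 < n ->
  (forall e, e \in H -> #|e| = 4%N) ->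
  (forall u v, u \in Q -> v \in P -> (1 / 3 + d) * n ^+ 2 <= link_deg H R P u v) ->
  (forall u v a b, u \in Q -> v \in P -> a \in P -> b \in P -> edge4 H u v a b ->
     (4 / 3 + d) * n ^+ 2 <= link_deg H R P u v + link_deg H R P u a) ->
  3 * (#|Z|%:R + 9) * #|V|%:R ^+ 2 <= d / 144 * n ^+ 3 ->
  quads Q P != set0 -> (forall x, x \in quads Q P -> 0 < phi x) ->
  exists A : {set V}, [/\ A != set0, (#|A| <= 12)%N, [disjoint A & Z], matchable H A &
    absorber_density d * \sum_(x in quads Q P) phi x
      <= \sum_(x in quads Q P) phi x * '1[ absorbs H A x ] ].
Proof.
move=> n QP d0 d12 Qn Vn n0 H4 dg1 dg2 hZ q0 phi0.
pose N := robust_nbr H Q P d.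
pose G (x : V * V * V * V) := absorbers H Q P N x.1.1.1 x.1.1.2 x.1.2 x.2 Z.
pose m : R := d / 144 * n ^+ 3.
have m0 : 0 < m by rewrite mulr_gt0 ?exprn_gt0 // divr_gt0.
have inP (x : V * V * V * V) : x \in quads Q P ->
    [/\ x.1.1.1 \in Q, x.1.1.2 \in P, x.1.2 \in P, x.2 \in P & uniq [:: x.1.1.2; x.1.2; x.2] ].
  by rewrite inE => /and5P.
have mG x : x \in quads Q P -> m ^+ 4 <= #|G x|%:R.
  case/inP => uQ v1P v2P v3P _; apply: (card_absorbers (ltW m0)).
    rewrite (card_set3 R P P P (fun a b c => [&& edge4 H x.1.1.1 a b c,
      a \in N x.1.1.2, b \in N x.1.2 & c \in N x.2])).
    apply: le_trans (robust_triple_ge d0 d12 Qn n0 dg1 dg2 uQ v1P v2P v3P).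
    by move: hZ m0; rewrite /m -/n; move: (3 * _ * _) => z hz; lra.
  move=> v v' vin v'N.
  rewrite (card_set3 R Q P P (fun u a b => edge4 H u v a b && edge4 H u v' a b)).
  have vP : v \in P by move: vin; rewrite !inE => /or3P[] /eqP ->.
  apply: le_trans (common_link_ge d0 n0 dg2 vP v'N).
  by move: hZ m0; rewrite /m -/n; move: (3 * _ * _) => z hz; lra.
have [t] := weighted_pick q0 phi0 (exprn_gt0 4 m0) mG.
have -> : m ^+ 4 / #|{: V * V * V * (V * V * V) * (V * V * V) * (V * V * V)}|%:R = absorber_density d.
  have -> : #|{: V * V * V * (V * V * V) * (V * V * V) * (V * V * V)}|%:R = (4 / 3 * n) ^+ 12 :> R.
    by rewrite -Vn !card_prod !natrM; ring.
  by rewrite /m /absorber_density; field; rewrite gt_eqF.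
move=> ht.
(* The selected share is positive, so the tuple absorbs some quadruple; this makes it disjoint from
   [Z] and matchable. *)
have [x xq tx] : exists2 x, x \in quads Q P & t \in G x.
  have [/exists_inP[x xq tx]|] := boolP [exists x in quads Q P, t \in G x]; first by exists x.
  rewrite negb_exists_in => /forall_inP hn; move: ht; rewrite [X in _ <= X]big1; last first.
    by move=> x xq; rewrite (negbTE (hn x xq)) mulr0.
  rewrite leNgt mulr_gt0 //.
    by rewrite mulr_gt0 // exprn_gt0 ?divr_gt0.
  have [x xq] := set0Pn _ q0; rewrite (bigD1 x) //= ltr_pwDl ?phi0 //.
  by apply: sumr_ge0 => y /andP[yq _]; exact/ltW/phi0.
have [aZ ut mt _] := absorbersP H4 tx.
exists [set y in tlist t]; split => //.
- by apply/set0Pn; exists t.1.1.1.1.1; rewrite !inE eqxx.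
- by rewrite cardsE; apply: leq_trans (card_size _) _.
- by apply/pred0P => y /=; rewrite inE; apply/negbTE/negP => /andP[/(allP aZ)/negbTE ->].
apply: le_trans ht _; apply: ler_sum => y yq.
apply: ler_wpM2l; first exact/ltW/phi0.
rewrite ler_nat; case ty: (t \in G y) => //; rewrite lt0b.
apply/implyP => dis; have [_ _ _ /(_ _)] := absorbersP H4 ty.
rewrite -set_seq_cat; apply.
rewrite cat_uniq ut andTb; apply/andP; split.
  apply/hasPn => z zy; apply/negP => zt.
  by move/pred0P: dis => /(_ z) /=; rewrite !in_set zy zt.
have [uQ v1P v2P v3P uv] := inP y yq.
rewrite /= in uv *; rewrite uv andbT.
have nu v : v \in P -> y.1.1.1 != v.
  by move=> vP; apply/eqP => uv'; move/pred0P: QP => /(_ v) /=; rewrite vP -uv' uQ.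
by rewrite !inE !negb_or !nu.
Qed.

Lemma matchable_balanced (V : finType) (H : {set {set V}}) (Q P X : {set V}) :
  (forall e, e \in H -> #|e :&: Q| = 1%N /\ #|e :&: P| = 3%N) ->
  matchable H X -> #|X :&: P| = (3 * #|X :&: Q|)%N.
Proof.
move=> H13 /existsP[M /and3P[/subsetP sM tM /eqP <-]].
have cE (S : {set V}) (Y : {set V}) : #|Y :&: S| = (\sum_(x in Y) (x \in S))%N.
  rewrite -sum1_card big_mkcond [RHS]big_mkcond /=; apply: eq_bigr => v _.
  by rewrite inE; case: (v \in Y); case: (v \in S).
rewrite !cE !big_trivIset //= big_distrr /=; apply: eq_bigr => e eM.
by rewrite -!cE; have [-> ->] := H13 e (sM e eM).
Qed.

(** * Assembly *)

Lemma link_deg_restrict (R : realFieldType) (V : finType) (H : {set {set V}}) (P Z : {set V}) u v :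
  link_deg H R P u v - 2 * #|P :&: Z|%:R * #|P|%:R <= link_deg H R (P :\: Z) u v.
Proof.
have restr (G : V -> R) : \sum_(b in P :\: Z) G b = \sum_(b in P) '1[ b \notin Z ] * G b.
  rewrite big_mkcond [RHS]big_mkcond /=; apply: eq_bigr => b _.
  by rewrite inE; case: (b \in P); case: (b \in Z); rewrite /= ?mul1r ?mul0r.
have cI : \sum_(b in P) '1[ b \in Z ] = #|P :&: Z|%:R :> R.
  rewrite -sum1_card natr_sum big_mkcond [RHS]big_mkcond /=; apply: eq_bigr => b _.
  by rewrite inE; case: (b \in P); case: (b \in Z).
have -> : 2 * #|P :&: Z|%:R * #|P|%:R = \sum_(b in P) \sum_(c in P) ('1[ b \in Z ] + '1[ c \in Z ]) :> R.
  by rewrite sum_pairD cI; ring.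
rewrite /link_deg restr -sumrB; apply: ler_sum => b _.
rewrite restr -sumrB mulr_sumr; apply: ler_sum => c _.
by case: (b \in Z); case: (c \in Z); case: (edge4 _ _ _ _ _); rewrite /= ?mul0r ?mul1r; lra.
Qed.

(** As [r >= rho n / 2], the power on the left is at most [exp (- 3 theta n)], while the one on the
    right is at least [exp (- theta n)]. With [4 n^4] bounding the number of quadruples, the total
    weight after [r] rounds is thus below the weight of one quadruple with [k] absorbers. *)
Lemma absorb_count_large (R : realType) (c rho : R) : 0 < c -> c <= 1 -> 0 < rho ->
  exists2 theta : R, 0 < theta & exists n3 : nat, forall n : nat, (n3 <= n)%N ->
  4 * n%:R ^+ 4 * (1 - c / 2) ^+ Num.trunc (rho * n%:R) < (1 / 2) ^+ Num.trunc (theta * n%:R).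
Proof.
move=> c0 c1 rho0; pose theta : R := c * rho / 12.
have theta0 : 0 < theta by rewrite divr_gt0 // mulr_gt0.
exists theta => //.
(* A fifth power beats [4 n^4]: [exp (2 theta n)] is at least [(2 theta n / 5)^5 = q n^5]. *)
pose q : R := (2 * theta / 5) ^+ 5.
have q0 : 0 < q by rewrite exprn_gt0 // divr_gt0 // mulr_gt0.
exists (Num.bound (4 / q) + Num.bound (2 / rho))%N => n hn.
have hn' : (Num.bound (4 / q))%:R + (Num.bound (2 / rho))%:R <= n%:R :> R by rewrite -natrD ler_nat.
have b1 : 4 / q < (Num.bound (4 / q))%:R by apply: archi_boundP; rewrite divr_ge0 // ltW.
have b2 : 2 / rho < (Num.bound (2 / rho))%:R by apply: archi_boundP; rewrite divr_ge0 // ltW.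
have z1 : 0 <= (Num.bound (4 / q))%:R :> R by [].
have z2 : 0 <= (Num.bound (2 / rho))%:R :> R by [].
have nq : 4 < q * n%:R by rewrite mulrC -ltr_pdivrMr //; lra.
have nr : 2 <= rho * n%:R by rewrite mulrC -ler_pdivrMr //; lra.
set N : R := n%:R in nq nr *.
have N0 : 0 < N by rewrite -(pmulr_rgt0 _ rho0); lra.
have /andP[r1 r2] := truncn_itv (le_trans (ler0n R 2) nr).
set r := Num.trunc (rho * N) in r1 r2 *.
have tN0 : 0 <= theta * N by apply: mulr_ge0; exact: ltW.
have /andP[k1 k2] := truncn_itv tN0.
set k := Num.trunc (theta * N) in k1 k2 *.
have rge : rho * N / 2 <= r%:R by move: r2; rewrite -natr1; lra.
pose e (x : R) := sequences.expR x.
have e0 x : 0 < e x by apply: exp.expR_gt0.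
have h1 : (1 - c / 2) ^+ r <= e (- (3 * (theta * N))).
  apply: (@le_trans _ _ (e (- (c / 2)) ^+ r)).
    apply: lerXn2r; rewrite ?nnegrE; [lra | exact/ltW/e0 | exact: exp.expR_ge1Dx].
  rewrite /e -exp.expRM_natl exp.ler_expR mulrN lerN2 /theta.
  have := ler_wpM2l (ltW c0) rge; lra.
have h2 : e (- (theta * N)) <= (1 / 2) ^+ k.
  apply: (@le_trans _ _ (e (-1) ^+ k)).
    by rewrite /e -exp.expRM_natl exp.ler_expR mulrN1 lerN2.
  apply: lerXn2r; rewrite ?nnegrE; [exact/ltW/e0 | lra |].
  rewrite /e exp.expRN -div1r ler_pdivrMr ?e0 //.
  have : 1 + 1 <= e 1 := exp.expR_ge1Dx 1.
  by rewrite /e; lra.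
apply: lt_le_trans h2.
have N4 : 0 <= 4 * N ^+ 4 by rewrite mulr_ge0 // exprn_ge0 // ltW.
apply: le_lt_trans (ler_wpM2l N4 h1) _.
have -> : e (- (theta * N)) = e (2 * (theta * N)) * e (- (3 * (theta * N))).
  by rewrite /e -exp.expRD; congr sequences.expR; ring.
rewrite ltr_pM2r //.
apply: (@lt_le_trans _ _ (q * N * N ^+ 4)).
  by rewrite ltr_pM2r // exprn_gt0.
have -> : q * N * N ^+ 4 = (2 * theta / 5 * N) ^+ 5 by rewrite /q; field.
have -> : e (2 * (theta * N)) = e (2 * theta / 5 * N) ^+ 5.
  by rewrite /e -exp.expRM_natl; congr sequences.expR; field.
apply: lerXn2r; rewrite ?nnegrE; [|exact/ltW/e0|].
  by apply: mulr_ge0; last exact: ltW; apply: divr_ge0 => //; apply: mulr_ge0 => //; exact: ltW.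
apply: le_trans (exp.expR_ge1Dx _); lra.
Qed.

Lemma quartic_le (R : realFieldType) (x : R) : 0 <= x ->
  4 / 3 * x * (4 / 3 * x) * (4 / 3 * x) * (4 / 3 * x) <= 4 * x ^+ 4.
Proof.
move=> x0; have -> : 4 / 3 * x * (4 / 3 * x) * (4 / 3 * x) * (4 / 3 * x) = 256 / 81 * x ^+ 4 by field.
apply: ler_wpM2r; [exact: exprn_ge0 | lra].
Qed.

(** The absorbing family covers a small set [Z]. Outside it the degree conditions hold with [d/2],
    so all but a [theta] share of the rest is matched. The leftover [U] has three vertices of [P]
    for each one of [Q], because edges do, and at most [k] vertices in [Q], so the family absorbs
    it. *)
Lemma perfect_of_link_deg (R : realType) (d : R) : 0 < d -> d <= 1 / 2 ->
  exists n0 : nat, forall (V : finType) (H : {set {set V}}) (Q P : {set V}),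
  [disjoint Q & P] -> Q :|: P = [set: V] -> (forall e, e \in H -> #|e| = 4%N) ->
  (forall e, e \in H -> #|e :&: Q| = 1%N /\ #|e :&: P| = 3%N) ->
  (3 * #|Q|)%N = #|P| -> (n0 <= #|P|)%N ->
  (forall u v, u \in Q -> v \in P -> (1 / 3 + d) * #|P|%:R ^+ 2 <= link_deg H R P u v) ->
  (forall u v a b, u \in Q -> v \in P -> a \in P -> b \in P -> edge4 H u v a b ->
     (4 / 3 + d) * #|P|%:R ^+ 2 <= link_deg H R P u v + link_deg H R P u a) ->
  matchable H [set: V].
Proof.
move=> d0 d12.
pose c : R := absorber_density d.
have c0 : 0 < c by rewrite mulr_gt0 // exprn_gt0 // divr_gt0.
have c1 : c <= 1.
  by rewrite mulr_ile1 ?exprn_ge0 ?exprn_ile1 //; lra.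
(* Then [Z] has at most [12 rho n = d n / (12 * 128)] vertices, small enough for [absorber_pick] and
   for the degrees lost outside [Z]. *)
pose rho : R := d / (144 * 128).
have rho0 : 0 < rho by rewrite divr_gt0 // mulr_gt0.
have c2 : c <= 2 by lra.
have c12 : 0 <= 1 - c / 2 by lra.
have [half0 half1] : (0 <= 1 / 2 :> R) /\ (1 / 2 <= 1 :> R) by split; lra.
have [theta theta0 [n3 large]] := absorb_count_large c0 c1 rho0.
have dh0 : 0 < d / 2 by rewrite divr_gt0.
have dh1 : d / 2 <= 1 by lra.
have [n2 near] := dense_near_perfect dh0 dh1 theta0.
exists (n3 + 2 * n2 + Num.bound (9 * 12 * 128 / d) + Num.bound (2 / theta) + 3)%N.
move=> V H Q P QP QPT H4 H13 QP3 hn dg1 dg2.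
set n : R := #|P|%:R in dg1 dg2.
have n3P : (n3 <= #|P|)%N by apply: leq_trans hn; rewrite -!addnA leq_addr.
have [n2P B1P B2P P3] : [/\ (2 * n2 <= #|P|)%N, (Num.bound (9 * 12 * 128 / d) <= #|P|)%N,
    (Num.bound (2 / theta) <= #|P|)%N & (3 <= #|P|)%N].
  move: hn; move: (Num.bound (9 * 12 * 128 / d)) (Num.bound (2 / theta)) #|P|.
  by clear => x y z; split; lia.
have nd : 9 * 12 * 128 <= d * n.
  rewrite [d * n]mulrC -ler_pdivrMr //; apply: (@le_trans _ _ (Num.bound (9 * 12 * 128 / d))%:R).
    by apply/ltW/archi_boundP; rewrite divr_ge0 ?mulr_ge0 // ltW.
  by rewrite ler_nat.
have nth : 2 <= theta * n.
  rewrite [theta * n]mulrC -ler_pdivrMr //; apply: (@le_trans _ _ (Num.bound (2 / theta))%:R).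
    by apply/ltW/archi_boundP; rewrite divr_ge0 // ltW.
  by rewrite ler_nat.
have n03 : 3 <= n by rewrite ler_nat.
have n0 : 0 < n by apply: lt_le_trans n03.
have Qn : #|Q|%:R = n / 3 :> R by rewrite /n -QP3 natrM mulrAC divff ?mul1r // pnatr_eq0.
have Vn : #|V|%:R = 4 / 3 * n.
  by rewrite -cardsT -QPT cardsU (disjoint_setI0 QP) cards0 subn0 natrD Qn -/n; field.
have large_n := large _ n3P; rewrite -/n in large_n.
have rn0 : 0 <= rho * n by apply: mulr_ge0; exact: ltW.
have tn0 : 0 <= theta * n by apply: mulr_ge0; exact: ltW.
have /andP[r1 _] := truncn_itv rn0; have /andP[k1 k2] := truncn_itv tn0.
set r := Num.trunc (rho * n) in r1 large_n; set k := Num.trunc (theta * n) in k1 k2 large_n.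
have r12 : 12 * r%:R <= d * n / (12 * 128).
  apply: le_trans (ler_wpM2l _ r1) _ => //; rewrite /rho; clear; lra.
have n3_0 : 0 < n ^+ 3 by apply: exprn_gt0.
have pick (Z : {set V}) (phi : V * V * V * V -> R) : quads Q P != set0 -> (#|Z| <= 12 * r)%N ->
    (forall x, x \in quads Q P -> 0 < phi x) ->
    exists A : {set V}, [/\ A != set0, (#|A| <= 12)%N, [disjoint A & Z], matchable H A &
      c * \sum_(x in quads Q P) phi x <= \sum_(x in quads Q P) phi x * '1[ absorbs H A x ] ].
  move=> q0 hZ phi0; apply: (absorber_pick QP d0 d12 Qn Vn n0 H4 dg1 dg2) => //.
  rewrite Vn -/n.
  have : #|Z|%:R <= 12 * r%:R :> R by rewrite -natrM ler_nat.
  move: #|Z|%:R => z hz.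
  have hz9 : z + 9 <= d * n / (6 * 128) by move: hz r12 nd; clear; lra.
  have n20 : 0 < n ^+ 2 by apply: exprn_gt0.
  have := ler_wpM2r (ltW n20) hz9.
  by rewrite exprMn !exprS expr0; clear; lra.
have [F [tF cF mF sF]] := absorbing_family (ltW c0) c2 pick (leq_addr 12 (12 * r)).
have cnt x : x \in quads Q P -> (k <= #|[set A in F | absorbs H A x]|)%N.
  move=> xq; rewrite leqNgt; apply/negP => hk.
  have l1 : (1 / 2) ^+ k <= (1 / 2) ^+ #|[set A in F | absorbs H A x]| :> R.
    by apply: ler_wiXn2l => //; exact: ltnW.
  have l2 : (1 / 2) ^+ #|[set A in F | absorbs H A x]| <= \sum_(x in quads Q P) (1 / 2) ^+ #|[set A in F | absorbs H A x]| :> R.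
    rewrite [leRHS](bigD1 x) //= lerDl; apply: sumr_ge0 => y _.
    by apply: exprn_ge0; rewrite divr_ge0.
  have l3 : #|quads Q P|%:R * (1 - c / 2) ^+ r <= 4 * n ^+ 4 * (1 - c / 2) ^+ r.
    apply: ler_wpM2r; first exact: exprn_ge0.
    apply: (@le_trans _ _ (#|{: V * V * V * V}|%:R)); first by rewrite ler_nat max_card.
    rewrite !card_prod !natrM Vn; exact: quartic_le (ltW n0).
  by have := le_lt_trans (le_trans l1 (le_trans l2 (le_trans sF l3))) large_n; rewrite ltxx.
have mcF : matchable H (cover F) by apply: matchable_cover.
have bal := matchable_balanced H13 mcF.
set Z := cover F in cF mcF bal.
have ZP : #|P :&: Z|%:R <= d * n / (12 * 128).
  apply: le_trans r12; rewrite -natrM ler_nat; apply: leq_trans cF.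
  exact/subset_leq_card/subsetIr.
pose P' := P :\: Z; pose Q' := Q :\: Z.
have P'P : #|P'|%:R <= n by rewrite ler_nat subset_leq_card // subsetDl.
have n2' : 0 < n ^+ 2 by apply: exprn_gt0.
have P'2 : #|P'|%:R ^+ 2 <= n ^+ 2 by apply: lerXn2r; rewrite ?nnegrE.
have P'n : n / 2 <= #|P'|%:R.
  have := cardsID Z P => /(congr1 (fun m => m%:R : R)); rewrite natrD -/n -/P'.
  by move: ZP (ler_wpM2r (ltW n0) d12) (ltW n0); clear; move=> *; lra.
have loss u v : link_deg H R P u v - d / 8 * n ^+ 2 <= link_deg H R P' u v.
  apply: le_trans (link_deg_restrict R H P Z u v); rewrite lerD2l lerN2.
  have h1 := ler_wpM2r (ltW n0) ZP.
  have h2 : 0 <= d * n * n by rewrite !mulr_ge0 // ltW.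
  by rewrite expr2 -/n; clear -h1 h2; lra.
have d14 x : 0 <= x -> (x + d / 2) * #|P'|%:R ^+ 2 <= (x + d / 2) * n ^+ 2.
  by move=> x0; apply: ler_wpM2l => //; apply: addr_ge0 => //; exact: ltW.
have [x13 x43] : (0 <= 1 / 3 :> R) /\ (0 <= 4 / 3 :> R) by split; apply: divr_ge0.
have dn2 : 0 < d * n ^+ 2 by apply: mulr_gt0.
have PQ' : Q' :|: P' = ~: Z by rewrite /Q' /P' -setDUl QPT setTD.
have [X XQP [mX hX]] : exists2 X : {set V}, X \subset Q' :|: P' &
    matchable H X /\ #|(Q' :|: P') :\: X|%:R <= theta * #|Q' :|: P'|%:R.
  apply: near => //.
  - exact: disjointWl (subsetDl _ _) (disjointWr (subsetDl _ _) QP).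
  - by rewrite /Q' /P' !cardsD mulnBr QP3 [P :&: Z]setIC bal [Q :&: Z]setIC.
  - rewrite -(ler_nat R); move: n2P; rewrite -(ler_nat R) natrM -/n; move: P'n; clear; lra.
  - move=> u v /setDP[uQ _] /setDP[vP _]; have := dg1 u v uQ vP; have := loss u v.
    by move: (d14 _ x13) dn2; clear; move=> *; lra.
  - move=> u v a b /setDP[uQ _] /setDP[vP _] /setDP[aP _] /setDP[bP _] he.
    have := dg2 u v a b uQ vP aP bP he; have := loss u v; have := loss u a.
    by move: (d14 _ x43) dn2; clear; move=> *; lra.
have XZ : [disjoint Z & X].
  by rewrite disjoint_sym disjoints_subset -PQ'.
pose U := ~: (Z :|: X).
have ZU : [disjoint Z & U] by rewrite -setI_eq0 /U setCU setIA setICr set0I.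
have mZX : matchable H (Z :|: X) by apply: matchableU.
have bU := matchable_balanced H13 mZX.
have UE : U = (Q' :|: P') :\: X by rewrite PQ' /U setCU setDE.
have UQP : U \subset Q :|: P by rewrite QPT subsetT.
have card_compl (S : {set V}) : #|U :&: S| = (#|S| - #|(Z :|: X) :&: S|)%N.
  by rewrite /U setIC -setDE cardsD [S :&: _]setIC.
have UP3 : #|U :&: P| = (3 * #|U :&: Q|)%N.
  by rewrite !card_compl mulnBr QP3 bU.
have Usmall : (#|U :&: Q| <= k)%N.
  have cU : #|U| = (#|U :&: Q| + #|U :&: P|)%N.
    by rewrite -{1}[U]setIT -QPT setIUr cardsU setIACA setIid (disjoint_setI0 QP) setI0 cards0 subn0.
  have : 4 * #|U :&: Q|%:R <= theta * (4 / 3 * n) :> R.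
    have -> : 4 * #|U :&: Q|%:R = #|U|%:R :> R by rewrite cU UP3 natrD natrM; ring.
    rewrite UE; apply: le_trans hX _; apply: ler_wpM2l; first exact: ltW.
    by rewrite -Vn ler_nat max_card.
  move=> hU; rewrite -ltnS -(ltr_nat R); apply: le_lt_trans k2.
  by move: hU tn0; clear; lra.
have mFU : matchable H (Z :|: U).
  apply: (absorb_all QP tF mF ZU UQP erefl UP3) => x xq.
  exact: leq_trans Usmall (cnt x xq).
have -> : [set: V] = (Z :|: U) :|: X.
  by rewrite /U setUAC setUCr.
apply: matchableU => //.
by rewrite -setI_eq0 setIUl (disjoint_setI0 XZ) set0U /U setCU -setIA [~: X :&: _]setIC setICr setI0.
Qed.

(** * From degrees to ordered link degrees *)

Lemma edge13_split (V : finType) (H : {set {set V}}) (Q P : {set V}) u v e :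
  Q :|: P = [set: V] -> (forall e, e \in H -> #|e :&: Q| = 1%N /\ #|e :&: P| = 3%N) ->
  e \in H -> u \in Q -> v \in P -> u \in e -> v \in e ->
  exists a b, [/\ a \in P, b \in P, a != b, v != a & e = [set u; v; a; b] ].
Proof.
move=> QPT H13 eH uQ vP ue ve; have [cQ cP] := H13 e eH.
have eQ : e :&: Q = [set u].
  apply/esym/eqP; rewrite eqEcard cQ cards1 andbT; apply/subsetP => w; rewrite !inE => /eqP ->.
  by rewrite ue.
have vIP : v \in e :&: P by rewrite inE ve.
have /cards2P[a [b [ab eab]]] : #|(e :&: P) :\ v| == 2%N.
  by have := cardsD1 v (e :&: P); rewrite vIP cP add1n => -[<-].
have aI : a \in (e :&: P) :\ v by rewrite eab !inE eqxx.
have bI : b \in (e :&: P) :\ v by rewrite eab !inE eqxx orbT.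
case/setD1P: aI => av /setIP[_ aP]; case/setD1P: bI => bv /setIP[_ bP].
exists a, b; split; rewrite // 1?eq_sym //.
rewrite -[LHS]setIT -QPT setIUr eQ -(setD1K vIP) eab.
by apply/setP => w; rewrite !inE -!orbA.
Qed.

(** Every edge through [u] and [v] yields two ordered pairs, and different edges yield different
    pairs. *)
Lemma deg_link_deg (R : realFieldType) (V : finType) (H : {set {set V}}) (Q P : {set V}) u v :
  Q :|: P = [set: V] -> (forall e, e \in H -> #|e :&: Q| = 1%N /\ #|e :&: P| = 3%N) ->
  u \in Q -> v \in P -> 2 * (deg H [set u; v])%:R <= link_deg H R P u v.
Proof.
move=> QPT H13 uQ vP; set D := [set e in H | [set u; v] \subset e].
apply: (@le_trans _ _ (\sum_(e in D) \sum_(b in P) \sum_(c in P) '1[ [set u; v; b; c] == e ])); last first.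
  rewrite exchange_big /=; apply: ler_sum => b _; rewrite exchange_big /=; apply: ler_sum => c _.
  case: (boolP ([set u; v; b; c] \in D)) => [fD|fD]; last first.
    by rewrite big1 // => e eD; case: eqP => // fe; rewrite fe eD in fD.
  rewrite (bigD1 _ fD) /= eqxx big1 ?addr0; last by move=> e /andP[_ /negbTE]; rewrite eq_sym => ->.
  by move: fD; rewrite inE /edge4 => /andP[-> _].
have -> : 2 * (deg H [set u; v])%:R = \sum_(e in D) 2 :> R by rewrite sumr_const mulr_natr.
apply: ler_sum => e; rewrite inE => /andP[eH /subsetP uve].
have [||a [b [aP bP ab _ eE]]] := edge13_split QPT H13 eH uQ vP; try by apply: uve; rewrite !inE eqxx ?orbT.
have eE' : [set u; v; b; a] = e by rewrite eE -!setUA [ [set b] :|: _]setUC.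
have one (w w' : V) : w' \in P -> [set u; v; w; w'] = e ->
    1 <= \sum_(c in P) '1[ [set u; v; w; c] == e ] :> R.
  by move=> wP we; rewrite (bigD1 w') //= we eqxx lerDl; apply: sumr_ge0.
rewrite (bigD1 a) //= -[2]/(1 + 1); apply: lerD; first exact: (one a b).
rewrite (bigD1 b) /=; last by rewrite bP eq_sym.
by apply: ler_wpDr (one b a aP eE'); apply: sumr_ge0 => w _; apply: sumr_ge0.
Qed.

Theorem theorem5 (R : realType) (delta : R) (delta_gt0 : 0 < delta) :
  exists n0 : nat, forall n : nat, (n0 <= n)%N -> (3 %| n)%N ->
  forall (V : finType) (H : {set {set V}}) (Q P : {set V}),
    kgraph 4 H -> partite13 H Q P ->
    #|P| = n -> #|Q| = (n %/ 3)%N ->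
    (forall u v : V, u \in Q -> v \in P -> adjacent H u v) ->
    (forall u v v' : V, u \in Q -> v \in P -> v' \in P -> v != v' ->
       (0 < deg H [set u; v; v'])%N ->
       (2%:R / 3%:R + delta) * n%:R ^+ 2
         < (deg H [set u; v])%:R + (deg H [set u; v'])%:R) ->
  exists M : {set {set V}}, perfect_matching H M.
Proof.
(* Link degrees count ordered pairs, so [2/3 + delta] doubles to [4/3 + 2 delta]; the cap [1/2] is
   the range of [perfect_of_link_deg]. *)
pose d := Num.min (2 * delta) (1 / 2).
have d0 : 0 < d by rewrite lt_min mulr_gt0 //= divr_gt0.
have d12 : d <= 1 / 2 by rewrite ge_min lexx orbT.
have d2 : d <= 2 * delta by rewrite ge_min lexx.
have [n0 main] := perfect_of_link_deg d0 d12.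
exists n0 => n hn n3 V H Q P /forall_inP H4' /and3P[QP /eqP QPT /forall_inP H13'] Pn Qn hadj hdeg.
have H4 e : e \in H -> #|e| = 4%N by move=> /H4'/eqP.
have H13 e : e \in H -> #|e :&: Q| = 1%N /\ #|e :&: P| = 3%N.
  by move=> /H13'/andP[/eqP -> /eqP ->].
have n20 : 0 <= n%:R ^+ 2 :> R by apply: exprn_ge0.
have sum_ge u v a b : u \in Q -> v \in P -> a \in P -> b \in P -> edge4 H u v a b ->
     (4 / 3 + d) * n%:R ^+ 2 <= link_deg H R P u v + link_deg H R P u a.
  move=> uQ vP aP bP he; have := card_set4_uniq (H4 _ he).
  rewrite /= !inE !negb_or => /and4P[_ /andP[va _] _ _].
  have dpos : (0 < deg H [set u; v; a])%N.
    apply/card_gt0P; exists [set u; v; a; b]; rewrite inE; apply/andP; split; first exact: he.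
    exact: subsetUl.
  have h1 := hdeg u v a uQ vP aP va dpos.
  have h2 := deg_link_deg R QPT H13 uQ vP; have h3 := deg_link_deg R QPT H13 uQ aP.
  have h4 := ler_wpM2r n20 d2.
  by move: h1 h2 h3 h4; clear; move=> *; lra.
have /existsP[M /and3P[sM tM cM]] : matchable H [set: V].
  apply: (main V H Q P) => //; rewrite ?Pn //.
  - by rewrite Qn mulnC divnK.
  (* By adjacency some edge contains [u] and [v]. A third vertex [a] of it has link degree at most
     [n^2], so the bound on the sum leaves [(1/3 + d) n^2] for [v]. *)
  - move=> u v uQ vP.
    have /andP[_ /exists_inP[e eH /andP[ue ve]]] := hadj u v uQ vP.
    have [a [b [aP bP ab va eE]]] := edge13_split QPT H13 eH uQ vP ue ve.
    have he : edge4 H u v a b by rewrite /edge4 -eE.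
    have h1 := sum_ge u v a b uQ vP aP bP he.
    have h2 : link_deg H R P u a <= n%:R ^+ 2.
      apply: (@le_trans _ _ (\sum_(b in P) \sum_(c in P) 1)).
        by apply: ler_sum_pair => b' c' _ _; rewrite lern1 leq_b1.
      by under eq_bigr do rewrite sum_const_set mulr1; rewrite sum_const_set Pn expr2.
    by move: h1 h2; clear; move=> *; lra.
by exists M; apply/and3P.
Qed.
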